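(* Let $\alpha,\beta>0$ be fixed and, for each $n\ge2$, let $T_s$ ($=T_s^{(n)}$) be the fastest time to stationarity for the dynamic Erdős–Rényi graph on $n$ vertices started in a given (deterministic) state. Then for all $x\in\mathbb{R}$, $$\mathbb{P}\left(\alpha T_s-2\log(n)+\log 2\le x\right)\to e^{-e^{-x}}\quad\text{as } n\to\infty.$$ Furthermore, $\mathbb{E}(T_s)=O(\log(n))$ as $n\to\infty$.
   Context: Dynamic Erdős–Rényi graph: fix $\alpha,\beta>0$ and an integer $n\ge 2$, and let $N=\binom n2$. There are $n$ fixed vertices. For each pair $\{u,v\}$ of distinct vertices, $\chi_{u,v}(t)\in\{0,1\}$ indicates whether an edge is present between $u$ and $v$ at time $t$, and $G(t)=(\chi_{1,2}(t),\dots,\chi_{n-1,n}(t))\in\{0,1\}^N$. Independently for each vertex pair, the state of the edge is updated at the points of a Poisson process with intensity $\alpha+\frac{\beta}{n-1}$; at each update, independently of the Poisson process and of previous states, the edge is present after the update with probability $p=\frac{\beta}{\beta+(n-1)\alpha}$ and absent with probability $1-p$. The unique stationary distribution of $\{G(t)\}$ is that of the static Erdős–Rényi graph $G(n,p)$. Let $\{\mathcal F_t\}$ be the filtration generated by the update times and corresponding edge updates up to time $t$ (with the initial state). Randomized stopping time: let $\mathcal F_\infty$ be the smallest $\sigma$-algebra containing all $\mathcal F_t$, and let $\mathcal G$ be a sub-$\sigma$-algebra of the underlying $\sigma$-algebra independent of $\mathcal F_\infty$. A random variable $T$ with values in $[0,\infty]$ is a randomized stopping time relative to $\{\mathcal F_t\}$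 if $\{T\le t\}\in\sigma(\mathcal F_t,\mathcal G)$ for every $t\ge0$ (for some such $\mathcal G$). Strong stationary time: for a process $X$ adapted to $\{\mathcal F_t\}$ with state space $S$ and unique stationary distribution $\pi$, a randomized stopping time $T$ is a strong stationary time for $X$ if $\mathbb P(T\le t,\ X(T)=y\mid T<\infty)=\mathbb P(T\le t\mid T<\infty)\,\pi(y)$ for all $0\le t<\infty$, $y\in S$. Fastest time to stationarity: a strong stationary time $T$ for $X$ such that $\mathbb P(T>t)\le\mathbb P(T'>t)$ for all $t$ and every other strong stationary time $T'$. For the dynamic Erdős–Rényi graph started in a given state, the paper takes $T_s=\max_{u,v}T_{u,v}$, where $T_{u,v}$ is the first update time of the pair $\{u,v\}$. *)

(* Defs.v *)
From mathcomp Require Export all_boot all_order all_algebra finmap.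
From mathcomp Require Export all_classical all_reals all_analysis measurable_realfun.

Set Implicit Arguments.
Unset Strict Implicit.
Unset Printing Implicit Defensive.

Import Order.TTheory GRing.Theory Num.Theory.
Export numFieldNormedType.Exports.

Local Open Scope classical_set_scope.
Local Open Scope ring_scope.

Section probability_notions.
Context {d : measure_display} {Omega : measurableType d} {R : realType}.
Variable P : probability Omega R.

(* Mutual independence of a family of classes of events: the product rule over
   every finite subfamily. *)
Definition mutually_independent (I : choiceType) (C : I -> set (set Omega)) :=
  forall (J : {fset I}) (A : I -> set Omega),
    (forall i, i \in J -> C i (A i)) ->
    (P (\bigcap_(i in [set` J]) A i) = \prod_(i <- J) P (A i))%E.

Definition independent (C D : set (set Omega)) :=
  forall A B : set Omega, C A -> D B -> (P (A `&` B) = P A * P B)%E.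

(* Pr(A | B); equal to 0 when P B = 0, by the convention x / 0 = 0 *)
Definition cond_prob (A B : set Omega) : R := fine (P (A `&` B)) / fine (P B).

Definition sigma_rv {d' : measure_display} {S : measurableType d'}
  (X : Omega -> S) : set (set Omega) := preimage_set_system setT X measurable.

Definition sigma_seq {d' : measure_display} {S : measurableType d'}
  (X : nat -> Omega -> S) : set (set Omega) := <<s \bigcup_k sigma_rv (X k) >>.

(* [tau k] is the time of the k-th point, k >= 0. *)
Definition counting_process (tau : nat -> Omega -> R) (t : R) (w : Omega) : nat :=
  #|` fset_set [set k | tau k w <= t] |.

(* The points of a Poisson process with intensity lambda on ]0, +oo[. The third
   condition makes the counting process finite.  Since it is nondecreasing in t,
   the truncated subtraction is the actual increment; the Poisson parameter
   is required only for s < t because [poisson_pmf] is not the Dirac mass at 0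
   when its parameter is 0. *)
Record poisson_process (lambda : R) (tau : nat -> Omega -> R) : Prop := {
  point_measurable : forall k, measurable_fun setT (tau k);
  point_gt0 : forall w, 0 < tau 0%N w;
  point_increasing : forall k w, tau k w < tau k.+1 w;
  point_unbounded : forall w, tau k w @[k --> \oo] --> +oo;
  poisson_increment : forall (s t : R) (k : nat), 0 <= s -> s < t ->
    P [set w | (counting_process tau t w - counting_process tau s w)%N = k]
      = (poisson_pmf (lambda * (t - s)) k)%:E;
  independent_increments : forall t : nat -> R,
    0 <= t 0%N -> (forall i, t i < t i.+1) ->
    mutually_independent (fun i : nat => sigma_rv (fun w =>
      (counting_process tau (t i.+1) w - counting_process tau (t i) w)%N))
}.

Section strong_stationary_times.
Variable F : R -> set (set Omega).

Definition F_infty : set (set Omega) := <<s \bigcup_(t in [set t | 0 <= t]) F t >>.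

Definition randomized_stopping_time (T : Omega -> \bar R) : Prop :=
  [/\ measurable_fun setT T,
      (forall w, 0 <= T w)%E &
      exists G : set (set Omega),
        [/\ sigma_algebra setT G,
            G `<=` measurable,
            independent G F_infty &
            forall t : R, 0 <= t -> <<s F t `|` G >> [set w | (T w <= t%:E)%E] ] ].

(* On {T <= t} the value of T is a real number, so that X(T) is [X (fine T)]. *)
Definition strong_stationary_time (S : Type) (X : R -> Omega -> S) (nu : S -> R)
    (T : Omega -> \bar R) : Prop :=
  randomized_stopping_time T /\
  forall (t : R) (y : S), 0 <= t ->
    cond_prob [set w | (T w <= t%:E)%E /\ X (fine (T w)) w = y]
              [set w | (T w < +oo)%E]
    = cond_prob [set w | (T w <= t%:E)%E] [set w | (T w < +oo)%E] * nu y.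

Definition fastest_time_to_stationarity (S : Type) (X : R -> Omega -> S)
    (nu : S -> R) (T : Omega -> \bar R) : Prop :=
  strong_stationary_time X nu T /\
  forall T' : Omega -> \bar R, strong_stationary_time X nu T' ->
    forall t : R, (P [set w | t%:E < T w] <= P [set w | t%:E < T' w])%E.

End strong_stationary_times.

End probability_notions.

(* unordered pairs of distinct vertices *)
Definition vpair (n : nat) : Type := {e : {set 'I_n} | #|e| == 2%N}.

Definition graph_state (n : nat) : Type := {ffun vpair n -> bool}.

Definition edge_rate {R : realType} (alpha beta : R) (n : nat) : R :=
  alpha + beta / n.-1%:R.

Definition edge_prob {R : realType} (alpha beta : R) (n : nat) : R :=
  beta / (beta + n.-1%:R * alpha).

(* probability mass function of G(n,p) *)
Definition erdos_renyi_pmf {R : realType} (n : nat) (p : R) (y : graph_state n) : R :=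
  \prod_(e : vpair n) (if y e then p else 1 - p).

Section dynamic_erdos_renyi.
Context {d : measure_display} {Omega : measurableType d} {R : realType}.
Variable P : probability Omega R.
Variable n : nat.
(* [tau e k] is the time of the k-th update of the pair e, k >= 0, and
   [upd e k] tells whether the edge is present after that update. *)
Variables (tau : vpair n -> nat -> Omega -> R) (upd : vpair n -> nat -> Omega -> bool).

(* For a given pair, [None] stands for the process of update times and
   [Some k] for the outcome of the k-th update. *)
Record dynamic_ER_updates (alpha beta : R) : Prop := {
  update_times : forall e, poisson_process P (edge_rate alpha beta n) (tau e);
  update_measurable : forall e k, measurable_fun setT (upd e k);
  update_law : forall e k,
    P [set w | upd e k w = true] = (edge_prob alpha beta n)%:E;
  update_independent : forall e,
    mutually_independent P (fun o : option nat =>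
      if o is Some k then sigma_rv (upd e k) else sigma_seq (tau e));
  pairs_independent :
    mutually_independent P (fun e : vpair n =>
      <<s sigma_seq (tau e) `|` sigma_seq (upd e) >>)
}.

Definition dynamic_ER (x0 : graph_state n) (t : R) (w : Omega) : graph_state n :=
  [ffun e => if counting_process (tau e) t w is k.+1 then upd e k w else x0 e].

(* The initial state, being deterministic, adds nothing to the filtration. *)
Definition update_filtration (t : R) : set (set Omega) :=
  <<s [set A | exists (e : vpair n) (k : nat) (s : R) (b : bool),
         s <= t /\ A = [set w | tau e k w <= s /\ upd e k w = b]] >>.

End dynamic_erdos_renyi.

(* Main.v *)
Require Import Defs.
From mathcomp Require Import ring lra.
Import Order.TTheory GRing.Theory Num.Theory.
Local Open Scope classical_set_scope.
Local Open Scope ring_scope.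

(** The fastest time to stationarity has an explicit law: with N vertex pairs
    and update rate lambda,
      P (T <= t) = (1 - exp (- lambda t)) ^ N   for all t >= 0,
    the law of the first time by which every pair has been updated
    ([fastest_time_law]).  Both claims are then computations with this law.

    P (T <= t) is at least this large because the time at which the last pair gets
    its first update is itself a strong stationary time
    ([full_update_time_sst]).  The outcomes of the updates are independent of
    the update times, and once all the update times are known, the graph at
    that moment shows exactly one outcome per pair, so it is an Erdos-Renyi
    graph independent of that time.

    P (T <= t) is at most this large for every strong stationary time T
    ([sst_law_bound]).  The chain is stationary from T on, so
    P (X t = y) >= P (T <= t) pi y for every state y.  Take for y the complement
    of the initial state: reaching it requires an update of every pair, and in
    fact P (X t = y) = (1 - exp (- lambda t)) ^ N pi y
    ([graph_transition_flip]).

    That the chain is stationary from T on is a strong Markov property at a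
    randomized stopping time.  It is reduced to the Markov property at
    deterministic times ([graph_markov_randomized]): T is rounded up to a grid
    of mesh delta, which changes the state only if some update falls within
    delta after T.  As update times do not accumulate, the probability of this
    event tends to 0 with delta ([near_update_cvg0]).

    The Markov property at deterministic times is built up from the data of the
    model: independent increments for one pair ([increment_indep]), the outcomes
    along one pair ([edge_past_indep], [edge_markov]), products over the pairs
    ([graph_markov]) and finally the extra randomization.  In each case the
    past is generated by a pi-system on which the claim is a product formula,
    and the two sides are finite measures in the event of the past
    ([pi_lambda_pr]).

    For t = (x + 2 log n - log 2) / alpha one has N exp (- lambda t) -> exp (- x),
    whence the Gumbel limit ([gumbel_limit]).  For the expectation, the union
    bound P (T > t) <= N exp (- alpha t) makes the tail beyond 2 log n / alpha
    geometric with ratio 1 / e along steps of length 1 / alpha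
    ([expectation_geometric_tail]). *)

Set Implicit Arguments.
Unset Strict Implicit.
Unset Printing Implicit Defensive.

(** * Real-valued probabilities, independence and extension from a pi-system *)

Section real_probability.
Context {d : measure_display} {Omega : measurableType d} {R : realType}.
Variable P : probability Omega R.
Implicit Types A B E Q : set Omega.

(** Products, differences and limits of probabilities are taken in [R], away
    from the infinities of the extended reals. *)
Definition rprob A : R := fine (P A).
Local Notation pr := rprob.

Lemma prE A : measurable A -> P A = (pr A)%:E.
Proof. by move=> mA; rewrite fineK// fin_num_measure. Qed.

Lemma pr_set0 : pr set0 = 0.
Proof. by rewrite /rprob measure0. Qed.

Lemma pr_setT : pr setT = 1.
Proof. by rewrite /rprob probability_setT. Qed.

Lemma pr_ge0 A : 0 <= pr A.
Proof. exact: fine_ge0. Qed.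

Lemma le_pr A B : measurable A -> measurable B -> A `<=` B -> pr A <= pr B.
Proof.
by move=> mA mB AB; rewrite -lee_fin -!prE//; apply: le_measure; rewrite ?inE.
Qed.

Lemma prU A B : measurable A -> measurable B -> A `&` B = set0 ->
  pr (A `|` B) = pr A + pr B.
Proof.
move=> mA mB AB; apply: EFin_inj; rewrite EFinD -!prE//; last exact: measurableU.
by rewrite measureU.
Qed.

Lemma pr_split B A : measurable A -> measurable B ->
  pr A = pr (A `&` B) + pr (A `&` ~` B).
Proof.
move=> mA mB; rewrite -prU; first by rewrite -setIUr setUv setIT.
- exact: measurableI.
- by apply: measurableI => //; exact: measurableC.
- by rewrite setIACA setICr setI0.
Qed.

Lemma prC A : measurable A -> pr (~` A) = 1 - pr A.
Proof.
by move=> mA; rewrite /rprob probability_setC// fineB// fin_num_measure.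
Qed.

Lemma pr_bigcup_cvg (F : nat -> set Omega) : (forall k, measurable (F k)) ->
  trivIset setT F -> series (pr \o F) n @[n --> \oo] --> pr (\bigcup_k F k).
Proof.
move=> mF tF.
have mU : measurable (\bigcup_k F k) by exact: bigcupT_measurable.
apply: (@fine_cvg _ _ _ _ (EFin \o series (pr \o F))).
rewrite fineK; last by rewrite fin_num_measure.
have := @measure_semi_sigma_additive _ _ _ P F mF tF mU.
apply: cvg_trans; apply: near_eq_cvg; near=> n.
rewrite /= /series /= -sumEFin.
by apply: eq_bigr => i _; rewrite -prE.
Unshelve. all: by end_near. Qed.

(** Both sides are finite measures in [B], so agreement on a pi-system
    extends to the generated sigma-algebra.  With [E] an event about the future
    and [Q] one about the present, this is the form in which every
    independence and Markov statement below is extended from generators. *)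
Lemma pi_lambda_pr (G : set (set Omega)) E Q (c : R) :
  setI_closed G -> G setT -> G `<=` measurable ->
  measurable E -> measurable Q ->
  (forall B, G B -> pr (B `&` E) = c * pr (B `&` Q)) ->
  forall B, <<s G >> B -> measurable B /\ pr (B `&` E) = c * pr (B `&` Q).
Proof.
move=> GI GT Gm mE mQ GEQ B sB.
suff : <<s G >> `<=` [set B | measurable B /\ pr (B `&` E) = c * pr (B `&` Q)].
  exact.
apply: (@lambda_system_subset _ _ GI) => //; last by move=> A GA; split; auto.
apply/dynkin_lambda_system; split => /=.
- by split => //; exact: GEQ.
- move=> A [mA AEQ]; split; first exact: measurableC.
  have CI D : measurable D -> pr (~` A `&` D) = pr D - pr (A `&` D).
    move=> mD; rewrite (pr_split mD mA) setIC [D `&` A]setIC.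
    by rewrite addrAC subrr add0r.
  rewrite !CI// AEQ mulrBr; congr (_ - _).
  by have := GEQ _ GT; rewrite !setTI.
- move=> F tF FEQ; split; first by apply: bigcupT_measurable => k; exact: (FEQ k).1.
  have tFI D : trivIset setT (fun k => F k `&` D).
    move=> i j _ _ [w [[Fi _] [Fj _]]]; apply: tF => //; by exists w.
  have mFI D : measurable D -> forall k, measurable (F k `&` D).
    by move=> mD k; apply: measurableI => //; exact: (FEQ k).1.
  have H1 := pr_bigcup_cvg (mFI _ mE) (tFI E).
  have H2 := pr_bigcup_cvg (mFI _ mQ) (tFI Q).
  rewrite !setI_bigcupl; apply: (cvg_unique (@Rhausdorff R) H1).
  have -> : series (pr \o (fun k => F k `&` E)) =
      (fun n => c * series (pr \o (fun k => F k `&` Q)) n).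
    apply/funext => n; rewrite /series /= mulr_sumr.
    by apply: eq_bigr => k _ /=; exact: (FEQ k).2.
  exact: cvgMr.
Qed.

Lemma pr_partition (f : Omega -> nat) E Q (c : R) :
  (forall j, measurable [set w | f w = j]) -> measurable E -> measurable Q ->
  (forall j, pr (E `&` [set w | f w = j]) = c * pr (Q `&` [set w | f w = j])) ->
  pr E = c * pr Q.
Proof.
move=> mf mE mQ fEQ.
have tf D : trivIset setT (fun k => D `&` [set w | f w = k]).
  by move=> i j _ _ [w [[_ <-] [_ <-]]].
have Uf D : \bigcup_k (D `&` [set w | f w = k]) = D.
  by apply/seteqP; split=> [w [k _ []]//|w Dw]; exists (f w).
have mFI D : measurable D -> forall k, measurable (D `&` [set w | f w = k]).
  by move=> mD k; exact: measurableI.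
have H1 := pr_bigcup_cvg (mFI _ mE) (tf E).
have H2 := pr_bigcup_cvg (mFI _ mQ) (tf Q).
rewrite !Uf in H1 H2; apply: (cvg_unique (@Rhausdorff R) H1).
have -> : series (pr \o (fun k => E `&` [set w | f w = k])) =
    (fun n => c * series (pr \o (fun k => Q `&` [set w | f w = k])) n).
  by apply/funext => n; rewrite /series /= mulr_sumr; apply: eq_bigr => k _ /=.
exact: cvgMr.
Qed.

Lemma mutually_independent_split (I : choiceType) (C : I -> set (set Omega))
    (J : {fset I}) (i : I) (A : I -> set Omega) :
  mutually_independent P C -> C i `<=` measurable ->
  (forall j, j \in J -> C j `<=` measurable) ->
  (i \notin J)%fset -> C i (A i) -> (forall j, j \in J -> C j (A j)) ->
  pr (A i `&` \bigcap_(j in [set` J]) A j) =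
    pr (A i) * pr (\bigcap_(j in [set` J]) A j).
Proof.
move=> ind mi mJ iJ CA CJ.
have mcap : measurable (\bigcap_(j in [set` J]) A j).
  by apply: fin_bigcap_measurable => // j /= jJ; exact: (mJ j jJ _ (CJ j jJ)).
have mAi := mi _ CA.
apply: EFin_inj; rewrite EFinM -!prE//; last exact: measurableI.
have -> : A i `&` \bigcap_(j in [set` J]) A j = \bigcap_(j in [set` (i |` J)%fset]) A j.
  apply/seteqP; split => [w [Ai AJ] j /=|w AJ].
    by rewrite !inE => /orP[/eqP ->//|jJ]; exact: AJ.
  split; first by apply: AJ; rewrite /= !inE eqxx.
  by move=> j jJ; apply: AJ; rewrite /= !inE; apply/orP; right.
rewrite ind; last first.
  by move=> j; rewrite !inE => /orP[/eqP ->//|jJ]; exact: CJ.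
by rewrite big_fsetU1//= ind.
Qed.

Lemma mutually_independent_fin (I : finType) (C : I -> set (set Omega))
    (A : I -> set Omega) :
  mutually_independent P C -> (forall i, C i `<=` measurable) ->
  (forall i, C i (A i)) ->
  pr (\bigcap_i A i) = \prod_i pr (A i).
Proof.
move=> ind mC CA.
have -> : \bigcap_i A i = \bigcap_(i in [set` [fset i | i in I]%fset]) A i.
  by apply/seteqP; split => w Aw i _; apply: Aw => //=; rewrite !inE.
rewrite /rprob ind; last by move=> i _; exact: CA.
rewrite (eq_bigr (fun i => (pr (A i))%:E)); last first.
  by move=> i _; rewrite prE//; exact: (mC i).
rewrite prodEFin/=.
apply: perm_big; apply: uniq_perm; rewrite ?fset_uniq ?index_enum_uniq//.
by move=> i; rewrite !inE mem_index_enum.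
Qed.

End real_probability.

(** * Events generated by countably many events *)

Section sigma_algebra_closure.
Context {T : Type} (S : set (set T)).
Hypothesis sS : sigma_algebra setT S.

Lemma salg0 : S set0. Proof. by case: sS. Qed.

Lemma salgC A : S A -> S (~` A).
Proof. by case: sS => _ SC _ /SC; rewrite setTD. Qed.

Lemma salg_bigcup (A : nat -> set T) : (forall k, S (A k)) -> S (\bigcup_k A k).
Proof. by case: sS => _ _; exact. Qed.

Lemma salgT : S setT. Proof. by rewrite -setC0; apply: salgC; exact: salg0. Qed.

Lemma salgI A B : S A -> S B -> S (A `&` B).
Proof. by have /sigma_algebraP[] := sS => // _ _ _; exact. Qed.

Lemma salgU A B : S A -> S B -> S (A `|` B).
Proof.
by move=> SA SB; rewrite -[_ `|` _]setCK setCU; apply/salgC/salgI; exact: salgC.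
Qed.

(** Finite intersections indexed by a list, the shape of the pi-system
    that generates the past of an edge. *)
Lemma salg_all (I : eqType) (l : seq I) (A : I -> set T) :
  (forall i, i \in l -> S (A i)) -> S [set w | forall i, i \in l -> A i w].
Proof.
elim: l => [_|i l IH SA].
  by rewrite (_ : mkset _ = setT); [exact: salgT|apply/seteqP; split].
rewrite (_ : mkset _ = A i `&` [set w | forall i, i \in l -> A i w]).
  apply: salgI; first by apply: SA; rewrite mem_head.
  by apply: IH => j jl; apply: SA; rewrite inE jl orbT.
apply/seteqP; split => [w Aw|w [Ai Al] j].
  by split; [apply: Aw; rewrite mem_head|move=> j jl; apply: Aw; rewrite inE jl orbT].
by rewrite inE => /orP[/eqP ->//|]; exact: Al.
Qed.

Lemma salg_bigcap_fin (I : finType) (A : I -> set T) :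
  (forall i, S (A i)) -> S (\bigcap_i A i).
Proof.
move=> SA; have := @salg_all _ (enum I) A (fun i _ => SA i).
rewrite (_ : mkset _ = \bigcap_i A i)//.
by apply/seteqP; split => w Aw i _; apply: Aw => //; rewrite mem_enum.
Qed.

Lemma salg_count (I : countType) (A : I -> set T) :
  (forall i, S (A i)) -> S [set w | exists i, A i w].
Proof.
move=> SA.
rewrite (_ : mkset _ = \bigcup_k (if @choice.unpickle I k is Some i then A i else set0)).
  by apply: salg_bigcup => k; case: choice.unpickle => [i|]; [exact: SA|exact: salg0].
apply/seteqP; split => [w [i Aw]|w [k _]]; first by exists (choice.pickle i); rewrite ?choice.pickleK.
by case: choice.unpickle => // i Ai; exists i.
Qed.

Lemma salg_preimage_count (I : countType) (f : T -> I) (V : set I) :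
  (forall j, S [set w | f w = j]) -> S [set w | V (f w)].
Proof.
move=> Sf.
rewrite (_ : mkset _ = [set w | exists j, ([set w | f w = j] `&` [set _ | V j]) w]).
  apply: salg_count => j; apply: salgI; first exact: Sf.
  have [Vj|Vj] := pselect (V j).
    by rewrite (_ : mkset _ = setT); [exact: salgT|apply/seteqP; split].
  by rewrite (_ : mkset _ = set0); [exact: salg0|apply/seteqP; split].
by apply/seteqP; split => [w Vw|w [j [/= -> ]]//]; exists (f w).
Qed.

Lemma salg_nat_eq (f : T -> nat) :
  (forall k, S [set w | (k < f w)%N]) -> forall j, S [set w | f w = j].
Proof.
move=> Sf j.
rewrite (_ : mkset _ = (if j is i.+1 then [set w | (i < f w)%N] else setT)
    `&` ~` [set w | (j < f w)%N]).
  apply: salgI; last exact: salgC.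
  by case: j => [|i]; [exact: salgT|exact: Sf].
apply/seteqP; split => [w /= fwj|w /=].
  by split => /=; [case: j fwj => [|j] //= -> //|rewrite fwj ltnn].
case: j => [[_ /negP]|j [/= ja /negP]]; first by rewrite -leqNgt leqn0 => /eqP.
by rewrite -leqNgt => fj; apply/eqP; rewrite eqn_leq fj.
Qed.

(** A rational separates the two values; so [g < f] is an event of every
    sigma-algebra containing the sublevel events, without [S] being the
    canonical sigma-algebra of the space. *)
Lemma salg_lt (R : realType) (f g : T -> R) :
  (forall r, S [set w | f w <= r]) -> (forall r, S [set w | g w <= r]) ->
  S [set w | g w < f w].
Proof.
move=> Sf Sg.
rewrite (_ : mkset _ = [set w | exists q : rat,
   ([set w | g w <= ratr q] `&` ~` [set w | f w <= ratr q]) w]).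
  by apply: salg_count => q; apply: salgI => //; exact: salgC.
apply/seteqP; split => w /=.
  move=> /rat_in_itvoo[q]; rewrite in_itv/= => /andP[gq qf]; exists q.
  by split; [exact: ltW|apply/negP; rewrite -ltNge].
by move=> [q [gq /negP]]; rewrite -ltNge => /(le_lt_trans gq).
Qed.

End sigma_algebra_closure.

Section partitions.
Context {d : measure_display} {Omega : measurableType d} {R : realType}.
Variable P : probability Omega R.
Local Notation pr := (rprob P).

Lemma pr_fin_partition (I : finType) (f : Omega -> I) (D : set Omega) :
  measurable D -> (forall i, measurable [set w | f w = i]) ->
  \sum_i pr (D `&` [set w | f w = i]) = pr D.
Proof.
move=> mD mf.
have mfl (l : seq I) : measurable [set w | f w \in l].
  exact: (@salg_preimage_count _ _ (@sigma_algebra_measurable _ Omega) I f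
    [set i | i \in l] mf).
suff H (l : seq I) : uniq l ->
    \sum_(i <- l) pr (D `&` [set w | f w = i]) = pr (D `&` [set w | f w \in l]).
  rewrite H ?index_enum_uniq//; congr (pr _).
  by apply/seteqP; split => [w []//|w Dw]; split => //=; exact: mem_index_enum.
elim: l => [_|i l IH /= /andP[il ul]].
  rewrite big_nil (_ : _ `&` _ = set0) ?pr_set0//.
  by apply/seteqP; split => // w [].
rewrite big_cons IH// -prU.
- congr (pr _); rewrite -setIUr; congr (_ `&` _).
  apply/seteqP; split => w /=; rewrite inE; first by case=> [->|->]; rewrite ?eqxx ?orbT.
  by case/orP => [/eqP|]; [left|right].
- exact: measurableI.
- exact: measurableI.
- apply/seteqP; split => // w /= [[_ fi] [_ fl]].
  by rewrite fi (negbTE il) in fl.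
Qed.

Lemma pr_partition_count (I : countType) (f : Omega -> I) (E Q : set Omega) (c : R) :
  (forall i, measurable [set w | f w = i]) -> measurable E -> measurable Q ->
  (forall i, pr (E `&` [set w | f w = i]) = c * pr (Q `&` [set w | f w = i])) ->
  pr E = c * pr Q.
Proof.
move=> mf mE mQ fEQ.
have H j : [set w | choice.pickle (f w) = j] = set0 \/
    exists i, [set w | choice.pickle (f w) = j] = [set w | f w = i].
  have [[w0 w0j]|nj] := pselect (exists w, choice.pickle (f w) = j); last first.
    by left; apply/seteqP; split => // w wj; apply: nj; exists w.
  right; exists (f w0); apply/seteqP; split => w /=; last by move=> ->.
  by rewrite -w0j => /(pcan_inj choice.pickleK).
apply: (pr_partition (f := fun w => choice.pickle (f w))) => // j.
  by case: (H j) => [->//|[i ->]].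
by case: (H j) => [->|[i ->//]]; rewrite !setI0 pr_set0 mulr0.
Qed.

End partitions.

Section comparison_events.
Context {d : measure_display} {Omega : measurableType d} {R : realType}.
Implicit Types f g : Omega -> R.

Lemma measurable_le_set f g : measurable_fun setT f -> measurable_fun setT g ->
  measurable [set w | f w <= g w].
Proof. by move=> mf mg; rewrite -[mkset _]setTI; exact: measurable_fun_le. Qed.

Lemma measurable_lt_set f g : measurable_fun setT f -> measurable_fun setT g ->
  measurable [set w | f w < g w].
Proof.
move=> mf mg; rewrite (_ : mkset _ = ~` [set w | g w <= f w]).
  by apply: measurableC; exact: measurable_le_set.
by apply/seteqP; split => w /=; rewrite ltNge => /negP.
Qed.

End comparison_events.

(** * The counting process of a Poisson process *)

Section poisson_counting.
Context {d : measure_display} {Omega : measurableType d} {R : realType}.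
Variables (P : probability Omega R) (lambda : R) (tau : nat -> Omega -> R).
Hypothesis Ptau : poisson_process P lambda tau.
Local Notation N := (counting_process tau).
Local Notation pr := (rprob P).

Lemma point_mono w i j : (i <= j)%N -> tau i w <= tau j w.
Proof.
move/subnK <-; elim: (j - i)%N => [|k IH]; first by rewrite add0n.
by rewrite addSn (le_trans IH)// ltW//; exact: (point_increasing Ptau).
Qed.

(** Since the points increase to infinity, those before [t] are an initial
    segment; the count and the positions determine each other. *)
Lemma lt_counting t w k : (k < N t w)%N = (tau k w <= t).
Proof.
have [m Hm] : exists m, forall k, (tau k w <= t) = (k < m)%N.
  have ex : exists m, t < tau m w.
    have /cvgryPgt /(_ t) [m _ Hm] := point_unbounded Ptau w.
    by exists m; apply: Hm => /=.
  exists (ex_minn ex); case: ex_minnP => m tm minm j.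
  have [jm|mj] := ltnP j m.
    by rewrite leNgt; apply/negP => /minm; rewrite leqNgt jm.
  by apply/negbTE; rewrite -ltNge (lt_le_trans tm)// point_mono.
rewrite Hm /counting_process.
rewrite (_ : [set k | _] = `I_m); last first.
  by apply/seteqP; split => j; rewrite /= Hm.
by rewrite (card_fset_set (card_eqxx `I_m)).
Qed.

Lemma counting_mono s t w : s <= t -> (N s w <= N t w)%N.
Proof.
move=> st; case E : (N s w) => [//|k].
by rewrite lt_counting (le_trans _ st)// -lt_counting E.
Qed.

Lemma counting_le0 t w : t <= 0 -> N t w = 0%N.
Proof.
move=> t0; apply/eqP; rewrite -leqn0 leqNgt lt_counting -ltNge.
exact: (le_lt_trans t0 (point_gt0 Ptau w)).
Qed.

Lemma sigma_seq_algebra : sigma_algebra setT (sigma_seq tau).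
Proof. exact: smallest_sigma_algebra. Qed.

Lemma sigma_seq_counting t j : sigma_seq tau [set w | N t w = j].
Proof.
apply: (salg_nat_eq sigma_seq_algebra) => k; apply: sub_sigma_algebra.
exists k => //; exists `]-oo, t]%classic; first exact: measurable_itv.
by rewrite setTI; apply/seteqP; split => w /=; rewrite in_itv/= lt_counting.
Qed.

Lemma sigma_seq_measurable : sigma_seq tau `<=` measurable.
Proof.
apply: smallest_sub; first exact: sigma_algebra_measurable.
move=> _ [k _ [B mB <-]]; exact: (point_measurable Ptau).
Qed.

Lemma sigma_seq_increment s t (V : set nat) :
  sigma_seq tau [set w | V (N t w - N s w)%N].
Proof.
apply: (@salg_preimage_count _ _ sigma_seq_algebra (nat * nat)%type
  (fun w => (N t w, N s w)) [set p | V (p.1 - p.2)%N]) => -[a b].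
rewrite (_ : mkset _ = [set w | N t w = a] `&` [set w | N s w = b]).
  by apply: (salgI sigma_seq_algebra); exact: sigma_seq_counting.
by apply/seteqP; split => w /= [-> ->].
Qed.

(** Independence of increments is assumed along infinite increasing
    sequences of times; a finite list of times is continued beyond its end by
    [t], [t + 1], and so on. *)
Definition grid (u : seq R) (t : R) (i : nat) : R :=
  if (i < size u)%N then nth 0 u i else t + (i - size u)%:R.

Lemma grid_lt u s t : sorted <%R u -> (forall r, r \in u -> r <= s) -> s < t ->
  forall i, grid u t i < grid u t i.+1.
Proof.
move=> su us st i; rewrite /grid.
have [iu|iu] := ltnP i.+1 (size u).
  by rewrite (ltnW iu); apply: (sorted_ltn_nth lt_trans); rewrite ?inE// ltnW.
have [iu'|iu'] := ltnP i (size u).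
  have -> : (i.+1 - size u)%N = 0%N by apply/eqP; rewrite subn_eq0.
  by rewrite addr0 (le_lt_trans _ st)// us// mem_nth.
by rewrite ltrD2l ltr_nat subSn.
Qed.

(** A future increment is independent of the counts in the past.  An event
    prescribing the counts at finitely many times is given here by a sample
    point [w0] that realizes it: prescribing the counts of [w0] amounts to
    prescribing its successive increments, because counts are nondecreasing and
    start from 0.  A prescription that no sample point realizes is empty, so
    nothing is lost. *)
Lemma increment_indep (u : seq R) (w0 : Omega) (s t : R) (i : nat) :
  0 <= s -> s < t -> s \in u -> (forall r, r \in u -> 0 <= r <= s) ->
  let B := [set w | forall r, r \in u -> N r w = N r w0] in
  pr (B `&` [set w | (N t w - N s w)%N = i])
    = pr B * poisson_pmf (lambda * (t - s)) i.
Proof.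
move=> s0 st su us B.
(* The count at time 0 is 0 everywhere, so adding 0 does not change [B], and
   it anchors the sums of increments. *)
pose v := sort <=%R (undup (0 :: u)).
have memv r : (r \in v) = (r == 0) || (r \in u).
  by rewrite mem_sort mem_undup inE.
have vs r : r \in v -> 0 <= r <= s.
  by rewrite memv => /orP[/eqP ->|/us//]; rewrite lexx.
have sv : sorted <%R v by rewrite sort_lt_sorted undup_uniq.
have v_gt0 : (0 < size v)%N.
  by have : 0 \in v; [rewrite memv eqxx|case: (v)].
pose q := (size v).-1; pose g := grid v t.
have qv : size v = q.+1 by rewrite prednK.
have gv r : r \in v -> exists2 j, (j <= q)%N & r = g j.
  move=> rv; exists (index r v); first by rewrite -ltnS -qv index_mem.
  by rewrite /g /grid index_mem rv nth_index.
have vg j : (j <= q)%N -> g j \in v.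
  by move=> jq; rewrite /g /grid qv ltnS jq mem_nth// qv.
have glt := @grid_lt v s t sv (fun r rv => (andP (vs r rv)).2) st.
have gmono : {homo g : i j / (i <= j)%N >-> i <= j}.
  apply: homo_leq => //; first exact: le_trans.
  by move=> j; exact/ltW/glt.
have g0 : g 0%N = 0.
  apply: le_anti; rewrite (andP (vs _ (vg _ _))).1// andbT.
  have [|j jq {1}->] := gv 0; first by rewrite memv eqxx.
  exact: gmono.
have gq : g q = s.
  apply: le_anti; rewrite (andP (vs _ (vg _ _))).2//=.
  have [|j jq {1}->] := gv s; first by rewrite memv su orbT.
  exact: gmono.
have gq1 : g q.+1 = t by rewrite /g /grid qv ltnn subnn addr0.
pose A j := if j == q then [set w | (N t w - N s w)%N = i] else
  [set w | (N (g j.+1) w - N (g j) w)%N = (N (g j.+1) w0 - N (g j) w0)%N].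
pose J : {fset nat} := [fset j in iota 0 q]%fset.
have JE j : (j \in J) = (j < q)%N by rewrite !inE mem_iota.
have BE : B = \bigcap_(j in [set` J]) A j.
  apply/seteqP; split => w Bw.
    move=> j /=; rewrite JE => jq; rewrite /A ltn_eqF//=.
    have Nv r : r \in v -> N r w = N r w0.
      by rewrite memv => /orP[/eqP ->|/Bw//]; rewrite !counting_le0.
    by rewrite !Nv// vg// ltnW.
  have Nw j : (j <= q)%N -> N (g j) w = N (g j) w0.
    elim: j => [_|j IH jq]; first by rewrite g0 !counting_le0.
    have := Bw j; rewrite /= JE jq => /(_ isT); rewrite /A ltn_eqF//= => Nj.
    have le x : (N (g j) x <= N (g j.+1) x)%N by apply: counting_mono; exact: gmono.
    by rewrite -(subnK (le w)) Nj IH ?subnK// ltnW.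
  by move=> r ru; have [|j jq ->] := gv r; [rewrite memv ru orbT|exact: Nw].
have ind := independent_increments Ptau (t := g).
have := mutually_independent_split (J := J) (i := q) (A := A) (ind _ glt).
rewrite g0 => /(_ (lexx _)).
have mC j : sigma_rv (fun w => (N (g j.+1) w - N (g j) w)%N) `<=` measurable.
  by move=> _ [V _ <-]; rewrite setTI; apply: sigma_seq_measurable; exact: sigma_seq_increment.
have AqE : A q = [set w | (N t w - N s w)%N = i] by rewrite /A eqxx.
rewrite -BE setIC -AqE => -> //.
- by rewrite mulrC AqE /rprob (poisson_increment Ptau).
- by rewrite JE ltnn.
- exists [set i] => //; rewrite setTI /A eqxx gq gq1; by apply/seteqP; split.
- move=> j; rewrite JE => jq; rewrite /A ltn_eqF//=.
  by exists [set (N (g j.+1) w0 - N (g j) w0)%N] => //; rewrite setTI; apply/seteqP; split.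
Qed.

End poisson_counting.

(** * The Markov property of one edge *)

Definition coin {R : realType} (p : R) (b : bool) : R := if b then p else 1 - p.

(** With probability [exp (- lambda u)] there is no update during a time
    [u] and the state [a] is kept; otherwise the new state is a fresh coin. *)
Definition edge_transition {R : realType} (lambda p u : R) (a b : bool) : R :=
  (a == b)%:R * expR (- (lambda * u)) + (1 - expR (- (lambda * u))) * coin p b.

Section edge_process.
Context {d : measure_display} {Omega : measurableType d} {R : realType}.
Variables (P : probability Omega R) (lambda p : R).
Variables (tau : nat -> Omega -> R) (upd : nat -> Omega -> bool).
Hypothesis lambda0 : 0 < lambda.
Hypothesis Ptau : poisson_process P lambda tau.
Hypothesis mupd : forall k, measurable_fun setT (upd k).
Hypothesis updp : forall k, P [set w | upd k w = true] = p%:E.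
Hypothesis indep : mutually_independent P (fun o : option nat =>
  if o is Some k then sigma_rv (upd k) else sigma_seq tau).
Local Notation N := (counting_process tau).
Local Notation pr := (rprob P).

(** The coordinate of [dynamic_ER] at one pair. *)
Definition edge_state (b0 : bool) (t : R) (w : Omega) : bool :=
  if N t w is k.+1 then upd k w else b0.

Definition edge_sigma : set (set Omega) := <<s sigma_seq tau `|` sigma_seq upd >>.

Definition edge_past (s : R) : set (set Omega) :=
  <<s [set A | exists (k : nat) (r : R) (b : bool),
         r <= s /\ A = [set w | tau k w <= r /\ upd k w = b]] >>.

Lemma edge_sigma_algebra : sigma_algebra setT edge_sigma.
Proof. exact: smallest_sigma_algebra. Qed.

Lemma edge_past_algebra s : sigma_algebra setT (edge_past s).
Proof. exact: smallest_sigma_algebra. Qed.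

Lemma sigma_rv_upd_measurable k : sigma_rv (upd k) `<=` measurable.
Proof. by move=> _ [B mB <-]; exact: mupd. Qed.

Lemma sigma_rv_upd k (V : set bool) : sigma_rv (upd k) [set w | V (upd k w)].
Proof. by exists V => //; rewrite setTI. Qed.

Lemma edge_sigma_upd k (V : set bool) : edge_sigma [set w | V (upd k w)].
Proof.
apply: sub_sigma_algebra; right; apply: sub_sigma_algebra; exists k => //.
exact: sigma_rv_upd.
Qed.

Lemma edge_sigma_counting t j : edge_sigma [set w | N t w = j].
Proof. apply: sub_sigma_algebra; left; exact: (sigma_seq_counting Ptau). Qed.

Lemma edge_sigma_measurable : edge_sigma `<=` measurable.
Proof.
apply: smallest_sub; first exact: sigma_algebra_measurable.
move=> A [|]; first exact: (sigma_seq_measurable Ptau).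
move: A; apply: smallest_sub; first exact: sigma_algebra_measurable.
by move=> A [k _]; exact: sigma_rv_upd_measurable.
Qed.

Lemma measurable_upd k (V : set bool) : measurable [set w | V (upd k w)].
Proof. by apply: edge_sigma_measurable; exact: edge_sigma_upd. Qed.

Lemma measurable_counting t j : measurable [set w | N t w = j].
Proof. by apply: edge_sigma_measurable; exact: edge_sigma_counting. Qed.

Lemma pr_upd k b : pr [set w | upd k w = b] = coin p b.
Proof.
have H : pr [set w | upd k w = true] = p by rewrite /rprob updp.
case: b => //=; rewrite -H -prC; last exact: (@measurable_upd k [set true]).
by congr (pr _); apply/seteqP; split => w /=; case: upd.
Qed.

Lemma edge_past_lt_counting t k : edge_past t [set w | (k < N t w)%N].
Proof.
rewrite (_ : mkset _ = [set w | tau k w <= t /\ upd k w = true] `|`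
   [set w | tau k w <= t /\ upd k w = false]).
  by apply: (salgU (edge_past_algebra t)); apply: sub_sigma_algebra;
    [exists k, t, true|exists k, t, false].
by apply/seteqP; split => w /=; rewrite (lt_counting Ptau);
  [case: upd => ?; [left|right]|case => -[]].
Qed.

Lemma edge_past_counting t j : edge_past t [set w | N t w = j].
Proof. apply: (salg_nat_eq (edge_past_algebra t)) => k; exact: edge_past_lt_counting. Qed.

Lemma edge_past_state b0 t b : edge_past t [set w | edge_state b0 t w = b].
Proof.
rewrite (_ : mkset _ = [set w | exists j, [set w | N t w = j /\
   (if j is k.+1 then upd k w else b0) = b] w]).
  apply: (salg_count (edge_past_algebra t)) => -[|k].
    have [->|bb] := eqVneq b0 b.
      rewrite (_ : mkset _ = [set w | N t w = 0%N]); first exact: edge_past_counting.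
      by apply/seteqP; split => w /=; [case|].
    rewrite (_ : mkset _ = set0); first exact: (salg0 (edge_past_algebra t)).
    by apply/seteqP; split => w //= [_ /eqP]; rewrite (negbTE bb).
  rewrite (_ : mkset _ = [set w | N t w = k.+1] `&`
      [set w | tau k w <= t /\ upd k w = b]).
    apply: (salgI (edge_past_algebra t)); first exact: edge_past_counting.
    by apply: sub_sigma_algebra; exists k, t, b.
  apply/seteqP; split => w /= [Nk] => [ub|[]//].
  by split => //; split => //; rewrite -(lt_counting Ptau) Nk.
apply/seteqP; split => w; rewrite /edge_state /=; first by move=> <-; exists (N t w).
by move=> [j [-> ]].
Qed.

(** Prescribing the count at [r], instead of only bounding [tau k] by [r],
    makes the past of the edge expressible through the increments of the
    counting process.  The condition [q.1.2 < q.1.1.2] says that the prescribed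
    outcome belongs to an update that has already taken place. *)
Definition mark (q : R * nat * nat * bool) : set Omega :=
  [set w | [/\ N q.1.1.1 w = q.1.1.2, (q.1.2 < q.1.1.2)%N & upd q.1.2 w = q.2]].

Definition cylinder (L : seq (R * nat * nat * bool)) : set Omega :=
  [set w | forall q, q \in L -> mark q w].

Definition cylinders (s : R) : set (set Omega) :=
  [set A | exists2 L, (forall q, q \in L -> q.1.1.1 <= s) & A = cylinder L].

Lemma mark_sigma q : edge_sigma (mark q).
Proof.
rewrite (_ : mark q = [set w | N q.1.1.1 w = q.1.1.2] `&`
   (if (q.1.2 < q.1.1.2)%N then [set w | upd q.1.2 w = q.2] else set0)).
  apply: (salgI edge_sigma_algebra); first exact: edge_sigma_counting.
  case: ifP => // _; first exact: (@edge_sigma_upd _ [set q.2]).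
  exact: (salg0 edge_sigma_algebra).
by rewrite /mark; case: ifP => h; apply/seteqP; split => w //=; case.
Qed.

Lemma cylinders_sigma s : cylinders s `<=` edge_sigma.
Proof.
by move=> _ [L _ ->]; apply: (salg_all edge_sigma_algebra) => q _; exact: mark_sigma.
Qed.

Lemma cylinders_measurable s : cylinders s `<=` measurable.
Proof. exact: subset_trans (@cylinders_sigma s) edge_sigma_measurable. Qed.

Lemma cylinders_setT s : cylinders s setT.
Proof. by exists [::] => //; apply/seteqP; split. Qed.

Lemma cylinders_setI s : setI_closed (cylinders s).
Proof.
move=> _ _ [L1 L1s ->] [L2 L2s ->]; exists (L1 ++ L2).
  by move=> q; rewrite mem_cat => /orP[/L1s|/L2s].
apply/seteqP; split => [w [w1 w2] q|w Hw].
  by rewrite mem_cat => /orP[/w1|/w2].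
by split => q qL; apply: Hw; rewrite mem_cat qL ?orbT.
Qed.

(** [tau k <= r] means that the count at [r] exceeds [k]; splitting over
    the value of the count writes each generator as a countable union of
    marks. *)
Lemma edge_past_cylinders s : edge_past s `<=` <<s cylinders s >>.
Proof.
apply: smallest_sub; first exact: smallest_sigma_algebra.
move=> _ [k [r [b [rs ->]]]].
have -> : [set w | tau k w <= r /\ upd k w = b] =
    [set w | exists m, cylinder [:: (r, m, k, b)] w].
  apply/seteqP; split => w /=.
    move=> [tr ub]; exists (N r w) => q; rewrite inE => /eqP -> /=.
    by split => //=; rewrite (lt_counting Ptau).
  move=> [m /(_ _ (mem_head _ _))] [/= Nm km ub]; split => //.
  by rewrite -(lt_counting Ptau) Nm.
apply: (salg_count (@smallest_sigma_algebra _ setT (cylinders s))) => m.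
apply: sub_sigma_algebra; exists [:: (r, m, k, b)] => // q.
by rewrite inE => /eqP ->.
Qed.

Lemma edge_past_sigma s : edge_past s `<=` edge_sigma.
Proof.
apply: subset_trans (@edge_past_cylinders s) _.
apply: smallest_sub; first exact: edge_sigma_algebra.
exact: cylinders_sigma.
Qed.

Lemma edge_past_measurable s : edge_past s `<=` measurable.
Proof. exact: subset_trans (@edge_past_sigma s) edge_sigma_measurable. Qed.

(** The outcome of one update is independent of the update times and of
    the outcomes of the updates in [K] jointly. *)
Lemma upd_indep (K : {fset nat}) (k : nat) (A0 : set Omega) (A : nat -> set bool)
    (V : set bool) :
  sigma_seq tau A0 -> k \notin K ->
  let U := [set w | forall k', k' \in K -> A k' (upd k' w)] in
  pr (A0 `&` (U `&` [set w | V (upd k w)])) = pr A0 * pr U * pr [set w | V (upd k w)].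
Proof.
move=> sA0 kK U.
pose C (o : option nat) := if o is Some k then sigma_rv (upd k) else sigma_seq tau.
have mC o : C o `<=` measurable.
  by case: o => [k'|]; [exact: sigma_rv_upd_measurable|exact: (sigma_seq_measurable Ptau)].
pose F (o : option nat) : set Omega := if o is Some k' then
  (if k' == k then [set w | V (upd k w)] else [set w | A k' (upd k' w)]) else A0.
have CF o : C o (F o).
  case: o => [k'|//]; rewrite /C /F; case: eqP => [->|_]; exact: sigma_rv_upd.
pose J := [fset Some k' | k' in K]%fset.
have UE : U = \bigcap_(o in [set` J]) F o.
  apply/seteqP; split => w Uw.
    move=> _ /imfsetP[k' /= k'K ->]; rewrite /F; case: eqP => [k'k|_]; last exact: Uw.
    by rewrite -k'k k'K in kK.
  move=> k' k'K; have := Uw (Some k'); rewrite /F.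
  case: eqP => [k'k|_]; first by rewrite -k'k k'K in kK.
  by apply; apply/imfsetP; exists k'.
have kJ : Some k \notin J.
  by apply/imfsetP => -[k' /= k'K [kk']]; rewrite kk' k'K in kK.
have F0 : F (Some k) = [set w | V (upd k w)] by rewrite /F eqxx.
have H1 := mutually_independent_split (C := C) (A := F) indep (mC (Some k))
  (fun j _ => mC j) kJ (CF _) (fun j _ => CF j).
have nJ : None \notin (Some k |` J)%fset.
  by rewrite !inE /=; apply/imfsetP => -[].
have := mutually_independent_split (C := C) (A := F) indep (mC None)
  (fun j _ => mC j) nJ (CF _) (fun j _ => CF j).
have -> : \bigcap_(j in [set` (Some k |` J)%fset]) F j = U `&` [set w | V (upd k w)].
  rewrite UE -F0; apply/seteqP; split => w.
    move=> H; split; last by apply: H; rewrite /= !inE eqxx.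
    by move=> j jJ; apply: H; rewrite /= !inE; apply/orP; right.
  by move=> [H1' H2'] j /=; rewrite !inE => /orP[/eqP ->//|]; exact: H1'.
by move=> ->; rewrite setIC UE -F0 H1 [F None]/= -mulrA [X in _ * X]mulrC.
Qed.

(** On [N s = j], a cylinder of the past only prescribes outcomes with
    index below [j]; since [j <= k], the outcome [k] is a fresh one. *)
Lemma cylinder_indep (s t : R) (j i k : nat) (V : set bool) B :
  0 <= s -> s < t -> (j <= k)%N -> cylinders s B ->
  pr (B `&` [set w | [/\ N s w = j, (N t w - N s w)%N = i & V (upd k w)]]) =
  poisson_pmf (lambda * (t - s)) i * pr [set w | V (upd k w)] *
    pr (B `&` [set w | N s w = j]).
Proof.
move=> s0 st jk [L Ls ->].
(* A sample point [w0] in the event turns the prescribed values into the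
   counts and outcomes of [w0], which are automatically consistent. *)
have [[w0 [Lw0 Nw0]]|] := pselect ((cylinder L `&` [set w | N s w = j]) !=set0); last first.
  move=> empty; rewrite (_ : _ `&` [set w | N s w = j] = set0); last first.
    by apply/seteqP; split => // w h; apply: empty; exists w.
  rewrite pr_set0 mulr0 (_ : _ `&` _ = set0) ?pr_set0//.
  by apply/seteqP; split => // w [Lw [h _ _]]; apply: empty; exists w.
pose u := s :: [seq q.1.1.1 | q <- L].
have us r : r \in u -> 0 <= r <= s.
  rewrite inE => /orP[/eqP ->|/mapP[q qL ->]]; first by rewrite s0 lexx.
  rewrite Ls// andbT leNgt; apply/negP => q0.
  have [N0 kq _] := Lw0 _ qL; move: kq; rewrite -N0 (counting_le0 Ptau)//.
  exact: ltW.
pose A0 := [set w | forall r, r \in u -> N r w = N r w0].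
pose K := [fset q.1.2 | q in L]%fset.
pose A k' := [set b | b = upd k' w0].
pose U := [set w | forall k', k' \in K -> A k' (upd k' w)].
have kK : k \notin K.
  apply/negP => /imfsetP[q /= qL kq]; have [Nq kltq _] := Lw0 _ qL.
  have : (k < j)%N.
    rewrite kq (leq_trans kltq)// -Nq -Nw0.
    by apply: (counting_mono Ptau); exact: Ls.
  by rewrite ltnNge jk.
have sA0 : sigma_seq tau A0.
  apply: (salg_all (sigma_seq_algebra tau)) => r _; exact: (sigma_seq_counting Ptau).
have LE : cylinder L `&` [set w | N s w = j] = A0 `&` U.
  apply/seteqP; split => w.
    move=> [Lw Nw]; split.
      move=> r; rewrite inE => /orP[/eqP ->|/mapP[q qL ->]]; first by rewrite Nw Nw0.
      by have [-> _ _] := Lw _ qL; have [-> _ _] := Lw0 _ qL.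
    move=> _ /imfsetP[q /= qL ->]; rewrite /A /=.
    by have [_ _ ->] := Lw _ qL; have [_ _ ->] := Lw0 _ qL.
  move=> [Aw Uw]; split; last by rewrite /= Aw ?mem_head.
  move=> q qL; have [Nq kq uq] := Lw0 _ qL; split => //.
    by rewrite Aw// inE; apply/orP; right; apply/mapP; exists q.
  by rewrite -uq; apply: Uw; apply/imfsetP; exists q.
have sA1 : sigma_seq tau (A0 `&` [set w | (N t w - N s w)%N = i]).
  apply: (salgI (sigma_seq_algebra tau)) => //.
  exact: (sigma_seq_increment Ptau s t [set i]).
have E1 := upd_indep A V sA1 kK.
have E2 := upd_indep A setT sA0 kK.
rewrite LE; have -> : cylinder L `&`
    [set w | [/\ N s w = j, (N t w - N s w)%N = i & V (upd k w)]] =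
    (A0 `&` [set w | (N t w - N s w)%N = i]) `&` (U `&` [set w | V (upd k w)]).
  apply/seteqP; split => w.
    move=> [Lw [Nw Nt Vw]]; have : (A0 `&` U) w by rewrite -LE.
    by move=> [].
  move=> [[A0w Nt] [Uw Vw]].
  by have : (A0 `&` U) w by []; rewrite -LE => -[].
rewrite E1 /= -/U; have -> : pr (A0 `&` U) = pr A0 * pr U.
  have T : [set w | [set: bool] (upd k w)] = [set: Omega] by apply/seteqP; split.
  by move: E2; rewrite T /= -/U setIT pr_setT mulr1.
rewrite (increment_indep Ptau w0 i s0 st (mem_head _ _) us).
by ring.
Qed.

Lemma edge_past_indep (s t : R) (j i k : nat) (V : set bool) B :
  0 <= s -> s < t -> (j <= k)%N -> edge_past s B ->
  pr (B `&` [set w | [/\ N s w = j, (N t w - N s w)%N = i & V (upd k w)]]) =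
  poisson_pmf (lambda * (t - s)) i * pr [set w | V (upd k w)] *
    pr (B `&` [set w | N s w = j]).
Proof.
move=> s0 st jk /edge_past_cylinders sB.
have := pi_lambda_pr (@cylinders_setI s) (cylinders_setT s) (@cylinders_measurable s)
  _ (measurable_counting s j) (fun B CB => cylinder_indep i V s0 st jk CB) sB.
case=> //; rewrite (_ : mkset _ = [set w | N s w = j] `&`
    [set w | (N t w - N s w)%N = i] `&` [set w | V (upd k w)]).
  apply: measurableI; last exact: measurable_upd.
  apply: measurableI; first exact: measurable_counting.
  apply: (sigma_seq_measurable Ptau).
  exact: (sigma_seq_increment Ptau s t [set i]).
by apply/seteqP; split => w /=; [case|case => -[]].
Qed.

Section transition.
Variables (s t : R) (B : set Omega).
Hypotheses (s0 : 0 <= s) (st : s < t) (pB : edge_past s B).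
Let mB := edge_past_measurable pB.

Let measurable_incr (V : set nat) : measurable [set w | V (N t w - N s w)%N].
Proof.
apply: (sigma_seq_measurable Ptau); exact: (sigma_seq_increment Ptau).
Qed.

Let idle := [set w | (N t w - N s w)%N = 0%N].

Lemma pr_no_update : pr (B `&` idle) = expR (- (lambda * (t - s))) * pr B.
Proof.
apply: (pr_partition (measurable_counting s)) => //.
  by apply: measurableI => //; exact: (@measurable_incr [set 0%N]).
move=> j; have := edge_past_indep 0 setT s0 st (leqnn j) pB.
rewrite {1}/poisson_pmf mulr_gt0// ?subr_gt0// expr0 fact0 invr1 !mul1r.
rewrite (_ : [set w | [set: bool] (upd j w)] = setT); last by apply/seteqP; split.
rewrite pr_setT mulr1 => <-; congr (pr _).
by apply/seteqP; split => w /=; [case=> -[? ?] ?|case=> ? []].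
Qed.

(** Given the counts at [s] and [t], the state at [t] is the outcome of one
    update later than [s]; which one depends on the counts only, so the answer
    is the same coin for all values of the counts. *)
Lemma pr_refreshed b0 b :
  pr (B `&` ~` idle `&` [set w | edge_state b0 t w = b]) =
    coin p b * pr (B `&` ~` idle).
Proof.
have mBi : measurable (B `&` ~` idle).
  by apply: measurableI => //; apply: measurableC; exact: (@measurable_incr [set 0%N]).
have mX : measurable [set w | edge_state b0 t w = b].
  by apply: (@edge_past_measurable t); exact: edge_past_state.
apply: (pr_partition (measurable_counting s)) => //; first exact: measurableI.
move=> j.
have mN := measurable_counting s j.
apply: (@pr_partition _ _ _ _ (fun w => (N t w - N s w)%N)).
- by move=> i; exact: (@measurable_incr [set i]).
- by apply: measurableI => //; exact: measurableI.
- exact: measurableI.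
move=> [|i].
  have Z (A : set Omega) : A `<=` ~` idle -> A `&` [set w | (N t w - N s w)%N = 0%N] = set0.
    by move=> Ai; apply/seteqP; split => // w [/Ai].
  by rewrite !Z ?pr_set0 ?mulr0// => w; [case=> -[]|case=> -[[]]].
have jji : (j <= j + i)%N by rewrite leq_addr.
transitivity (pr (B `&` [set w | [/\ N s w = j, (N t w - N s w)%N = i.+1 &
    [set b] (upd (j + i)%N w)]])).
  congr (pr _); apply/seteqP; split => w /=.
    move=> [[[[Bw _] Xb] Nj] Ni]; split => //; split => //; rewrite -Xb /edge_state.
    have st' : (N s w <= N t w)%N by apply: (counting_mono Ptau); exact: ltW.
    by rewrite -(subnK st') Ni Nj addSn addnC.
  move=> [Bw [Nj Ni Ub]]; split => //; split => //; split; last first.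
    rewrite -Ub /edge_state.
    have st' : (N s w <= N t w)%N by apply: (counting_mono Ptau); exact: ltW.
    by rewrite -(subnK st') Ni Nj addSn addnC.
  by split => //; rewrite /idle /= Ni.
rewrite edge_past_indep// pr_upd.
transitivity (coin p b * pr (B `&` [set w | [/\ N s w = j, (N t w - N s w)%N = i.+1 &
    [set: bool] (upd (j + i)%N w)]])).
  rewrite edge_past_indep// (_ : [set w | [set: bool] (upd _ w)] = setT); last first.
    by apply/seteqP; split.
  by rewrite pr_setT mulr1 [X in X * _]mulrC -mulrA.
congr (_ * pr _); apply/seteqP; split => w /=.
  by move=> [Bw [Nj Ni _]]; split => //; split => //; split => //; rewrite /idle /= Ni.
by move=> [[[Bw _] Nj] Ni].
Qed.

End transition.

(** The event is split according to whether an update takes place between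
    [s] and [t]; the two summands of [edge_transition] are the two cases. *)
Lemma edge_markov (s t : R) B b0 a b :
  0 <= s -> s <= t -> edge_past s B ->
  pr (B `&` [set w | edge_state b0 s w = a] `&` [set w | edge_state b0 t w = b]) =
  pr (B `&` [set w | edge_state b0 s w = a]) * edge_transition lambda p (t - s) a b.
Proof.
move=> s0; rewrite le_eqVlt => /orP[/eqP <-|st] pB.
  rewrite subrr /edge_transition mulr0 oppr0 expR0 subrr mul0r addr0 mulr1.
  have [->|ab] := eqVneq a b; first by rewrite -setIA setIid mulr1.
  rewrite mulr0 (_ : _ `&` _ = set0) ?pr_set0//.
  by apply/seteqP; split => // w /= [[_ ->]] /eqP; rewrite (negbTE ab).
set B' := B `&` _.
have pB' : edge_past s B'.
  by apply: (salgI (edge_past_algebra s)) => //; exact: edge_past_state.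
have mB' := edge_past_measurable pB'.
have mX : measurable [set w | edge_state b0 t w = b].
  by apply: (@edge_past_measurable t); exact: edge_past_state.
pose idle := [set w | (N t w - N s w)%N = 0%N].
have mi : measurable idle.
  apply: (sigma_seq_measurable Ptau); exact: (sigma_seq_increment Ptau s t [set 0%N]).
have E := pr_no_update s0 st pB'.
rewrite (pr_split _ (measurableI _ _ mB' mX) mi).
have -> : pr (B' `&` [set w | edge_state b0 t w = b] `&` ~` idle) =
    coin p b * (pr B' - expR (- (lambda * (t - s))) * pr B').
  rewrite setIAC (pr_refreshed s0 st pB'); congr (_ * _).
  by rewrite -/idle -E (pr_split _ mB' mi) addrAC subrr add0r.
have -> : pr (B' `&` [set w | edge_state b0 t w = b] `&` idle) =
    (a == b)%:R * (expR (- (lambda * (t - s))) * pr B').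
  have Xi w : idle w -> edge_state b0 t w = edge_state b0 s w.
    rewrite /idle /= => Ni; rewrite /edge_state.
    have st' : (N s w <= N t w)%N by apply: (counting_mono Ptau); exact: ltW.
    by rewrite -(subnK st') Ni add0n.
  have [ab|ab] := eqVneq a b.
    rewrite mul1r -E; congr (pr _); apply/seteqP; split => w.
      by move=> [[? _] ?].
    by move=> [B'w iw]; split => //; split => //=; rewrite Xi// -ab; case: B'w.
  rewrite mul0r (_ : _ `&` _ = set0) ?pr_set0//.
  apply/seteqP; split => // w /= [[[_ Xs] Xt] /Xi]; rewrite Xs Xt => /esym/eqP.
  by rewrite (negbTE ab).
rewrite /edge_transition; set x := expR _.
by ring.
Qed.

End edge_process.

(** * The Markov property of the graph *)

Section transition_kernel.
Context {R : realType} (n : nat) (lambda p : R).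
Hypotheses (lambda0 : 0 < lambda) (p01 : 0 < p < 1).

Definition graph_transition (u : R) (x y : graph_state n) : R :=
  \prod_e edge_transition lambda p u (x e) (y e).

Lemma coin_gt0 b : 0 < coin p b.
Proof. by case/andP: p01 => p0 p1; case: b => //=; rewrite subr_gt0. Qed.

Lemma coin_le1 b : coin p b <= 1.
Proof.
by case/andP: p01 => p0 p1; case: b => /=; lra.
Qed.

Lemma decay_itv u : 0 <= u -> 0 < expR (- (lambda * u)) <= 1.
Proof.
by move=> u0; rewrite expR_gt0 /= -expR0 ler_expR oppr_le0 mulr_ge0// ltW.
Qed.

Lemma edge_transition_ge0 u a b : 0 <= u -> 0 <= edge_transition lambda p u a b.
Proof.
move=> /decay_itv/andP[E0 E1]; apply: addr_ge0; apply: mulr_ge0.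
- by rewrite ler0n.
- exact: ltW.
- by rewrite subr_ge0.
- exact/ltW/coin_gt0.
Qed.

Lemma edge_transition_le1 u a b : 0 <= u -> edge_transition lambda p u a b <= 1.
Proof.
move=> /decay_itv/andP[E0 E1].
have c1 := coin_le1 b; rewrite /edge_transition.
have : (1 - expR (- (lambda * u))) * coin p b <= 1 - expR (- (lambda * u)).
  by rewrite ler_piMr// subr_ge0.
by case: (a == b) => /=; lra.
Qed.

Lemma graph_transition_ge0 u x y : 0 <= u -> 0 <= graph_transition u x y.
Proof. by move=> u0; apply: prodr_ge0 => e _; exact: edge_transition_ge0. Qed.

Lemma graph_transition_le1 u x y : 0 <= u -> graph_transition u x y <= 1.
Proof.
move=> u0; apply: prodr_ile1 => e _.
by rewrite edge_transition_ge0// edge_transition_le1.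
Qed.

Lemma erdos_renyi_pmf_gt0 (y : graph_state n) : 0 < erdos_renyi_pmf p y.
Proof. by apply: prodr_gt0 => e _; exact: (coin_gt0 (y e)). Qed.

(** Both factors are products over the pairs, so exchanging sum and
    product reduces the invariance to that of the coin for one pair. *)
Lemma erdos_renyi_invariant u (y : graph_state n) :
  \sum_x erdos_renyi_pmf p x * graph_transition u x y = erdos_renyi_pmf p y.
Proof.
rewrite /erdos_renyi_pmf /graph_transition.
under eq_bigr do rewrite -big_split /=.
rewrite -(bigA_distr_bigA (fun (e : vpair n) (b : bool) =>
  coin p b * edge_transition lambda p u b (y e))).
apply: eq_bigr => e _; rewrite big_bool /= /edge_transition.
by case: (y e) => /=; ring.
Qed.

(** To reach the complement of the initial state every pair must be
    updated, so no factor has the term of an idle pair.  The ratio of this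
    probability to the stationary weight is the smallest possible one, which is
    why this state gives a sharp bound on strong stationary times. *)
Lemma graph_transition_flip u (x : graph_state n) :
  graph_transition u x [ffun e => ~~ x e] =
  (1 - expR (- (lambda * u))) ^+ #|{: vpair n}| * erdos_renyi_pmf p [ffun e => ~~ x e].
Proof.
rewrite /graph_transition /erdos_renyi_pmf -prodr_const -big_split /=.
apply: eq_bigr => e _; rewrite /edge_transition !ffunE.
by case: (x e) => /=; rewrite mul0r add0r.
Qed.

End transition_kernel.

Section graph_process.
Context {d : measure_display} {Omega : measurableType d} {R : realType}.
Variables (P : probability Omega R) (n : nat) (alpha beta : R).
Variables (tau : vpair n -> nat -> Omega -> R) (upd : vpair n -> nat -> Omega -> bool).
Variable x0 : graph_state n.
Hypothesis HER : dynamic_ER_updates P tau upd alpha beta.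
Let lambda := edge_rate alpha beta n.
Let p := edge_prob alpha beta n.
Hypothesis lambda0 : 0 < lambda.
Local Notation pr := (rprob P).
Local Notation X := (dynamic_ER tau upd x0).
Local Notation F := (update_filtration tau upd).

Let Ptau e := update_times HER e.
Let mupd e := update_measurable HER e.

Lemma dynamic_ERE t w e : X t w e = edge_state (tau e) (upd e) (x0 e) t w.
Proof. by rewrite ffunE. Qed.

Lemma state_capE t x :
  [set w | X t w = x] = \bigcap_e [set w | edge_state (tau e) (upd e) (x0 e) t w = x e].
Proof.
apply/seteqP; split => [w /= <- e _|w Xw] /=; first by rewrite dynamic_ERE.
by apply/ffunP => e; rewrite dynamic_ERE Xw.
Qed.

Lemma filtration_algebra t : sigma_algebra setT (F t).
Proof. exact: smallest_sigma_algebra. Qed.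

Lemma filtration_mono s t : s <= t -> F s `<=` F t.
Proof.
move=> st; apply: sub_sigma_algebra2 => _ [e [k [r [b [rs ->]]]]].
by exists e, k, r, b; rewrite (le_trans rs st).
Qed.

Lemma edge_past_filtration e t : edge_past (tau e) (upd e) t `<=` F t.
Proof.
apply: sub_sigma_algebra2 => _ [k [r [b [rs ->]]]].
by exists e, k, r, b.
Qed.

Lemma filtration_state t x : F t [set w | X t w = x].
Proof.
rewrite state_capE; apply: (salg_bigcap_fin (filtration_algebra t)) => e.
by apply: (@edge_past_filtration e); exact: (edge_past_state (Ptau e)).
Qed.

Lemma filtration_measurable t : F t `<=` measurable.
Proof.
apply: smallest_sub; first exact: sigma_algebra_measurable.
move=> _ [e [k [r [b [rs ->]]]]].
apply: (edge_past_measurable (Ptau e) (mupd e) (s := r)).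
by apply: sub_sigma_algebra; exists k, r, b.
Qed.

Lemma measurable_state t x : measurable [set w | X t w = x].
Proof. by apply: (@filtration_measurable t); exact: filtration_state. Qed.

Lemma pr_edge_prod (A : vpair n -> set Omega) :
  (forall e, edge_sigma (tau e) (upd e) (A e)) ->
  pr (\bigcap_e A e) = \prod_e pr (A e).
Proof.
apply: (mutually_independent_fin (pairs_independent HER)) => e.
exact: (edge_sigma_measurable (Ptau e) (mupd e)).
Qed.

Definition rectangles (s : R) : set (set Omega) :=
  [set A | exists2 B : vpair n -> set Omega,
     (forall e, edge_past (tau e) (upd e) s (B e)) & A = \bigcap_e B e].

Lemma filtration_rectangles s : F s `<=` <<s rectangles s >>.
Proof.
apply: sub_sigma_algebra2 => _ [e [k [r [b [rs ->]]]]].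
exists (fun e' => if e' == e then [set w | tau e k w <= r /\ upd e k w = b] else setT).
  move=> e'; case: eqP => [->|_]; first by apply: sub_sigma_algebra; exists k, r, b.
  exact: (salgT (edge_past_algebra _ _ _)).
apply/seteqP; split => w; first by move=> H e' _; case: eqP.
by move=> /(_ e I); rewrite eqxx.
Qed.

(** A rectangle splits into one event per pair, and independence of the
    pairs reduces the claim to [edge_markov]. *)
Lemma graph_markov (s t : R) B x y :
  0 <= s -> s <= t -> F s B ->
  pr (B `&` ([set w | X s w = x] `&` [set w | X t w = y])) =
  graph_transition lambda p (t - s) x y * pr (B `&` [set w | X s w = x]).
Proof.
move=> s0 st /filtration_rectangles sB.
have mI := measurableI _ _ (measurable_state s x) (measurable_state t y).
have mR : rectangles s `<=` measurable.
  move=> _ [C pC ->]; apply: (salg_bigcap_fin (@sigma_algebra_measurable _ Omega)) => e.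
  exact: (edge_past_measurable (Ptau e) (mupd e)) (pC e).
apply: (pi_lambda_pr _ _ mR mI (measurable_state s x) _ sB).2.
- move=> _ _ [B1 pB1 ->] [B2 pB2 ->]; exists (fun e => B1 e `&` B2 e).
    by move=> e; apply: (salgI (edge_past_algebra _ _ _)).
  by rewrite bigcapI.
- exists (fun=> setT); first by move=> e; exact: (salgT (edge_past_algebra _ _ _)).
  by apply/seteqP; split.
move=> _ [C pC ->].
pose Xs e := [set w | edge_state (tau e) (upd e) (x0 e) s w = x e].
pose Xt e := [set w | edge_state (tau e) (upd e) (x0 e) t w = y e].
have pastS r e A : edge_past (tau e) (upd e) r A -> edge_sigma (tau e) (upd e) A.
  exact: (edge_past_sigma (Ptau e)).
have sCX e : edge_past (tau e) (upd e) s (C e `&` Xs e).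
  by apply: (salgI (edge_past_algebra _ _ _)) => //; exact: (edge_past_state (Ptau e)).
rewrite !state_capE setIA -!bigcapI !pr_edge_prod; first last.
- move=> e; apply: (salgI (edge_sigma_algebra _ _)); first exact: pastS (sCX e).
  by apply: (pastS t); exact: (edge_past_state (Ptau e)).
- by move=> e; exact: pastS (sCX e).
rewrite /graph_transition -big_split /=; apply: eq_bigr => e _.
rewrite (edge_markov lambda0 (Ptau e) (mupd e) (update_law HER e) (update_independent HER (e := e)))//.
exact: mulrC.
Qed.

(** Events of [G] are independent of the whole evolution, hence factor out
    of both sides of [graph_markov]. *)
Lemma graph_markov_randomized (G : set (set Omega)) (s t : R) A x y :
  sigma_algebra setT G -> G `<=` measurable -> independent P G (F_infty F) ->
  0 <= s -> s <= t -> <<s F s `|` G >> A ->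
  measurable A /\
  pr (A `&` ([set w | X s w = x] `&` [set w | X t w = y])) =
  graph_transition lambda p (t - s) x y * pr (A `&` [set w | X s w = x]).
Proof.
move=> sG mG iG s0 st sA.
pose H := [set A | exists B C, [/\ F s B, G C & A = B `&` C]].
have FH : <<s F s `|` G >> `<=` <<s H >>.
  apply: sub_sigma_algebra2 => D [FD|GD].
    by exists D, setT; rewrite setIT; split => //; exact: (salgT sG).
  by exists setT, D; rewrite setTI; split => //; exact: (salgT (filtration_algebra s)).
have mI := measurableI _ _ (measurable_state s x) (measurable_state t y).
apply: pi_lambda_pr (FH _ sA) => //.
- move=> _ _ [B1 [C1 [FB1 GC1 ->]]] [B2 [C2 [FB2 GC2 ->]]].
  exists (B1 `&` B2), (C1 `&` C2); rewrite setIACA; split => //.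
    exact: (salgI (filtration_algebra s)).
  exact: (salgI sG).
- exists setT, setT; rewrite setIT; split => //; [|exact: (salgT sG)].
  exact: (salgT (filtration_algebra s)).
- move=> _ [B [C [FB GC ->]]]; apply: measurableI; last exact: mG.
  exact: (@filtration_measurable s).
- exact: measurable_state.
move=> _ [B [C [FB GC ->]]].
have ind D : F t D -> pr (C `&` D) = pr C * pr D.
  move=> FD; have mD := filtration_measurable FD.
  apply: EFin_inj; rewrite EFinM -!prE//; [|exact: mG|by apply: measurableI => //; exact: mG].
  apply: iG => //; apply: sub_sigma_algebra; exists t => //=.
  exact: le_trans st.
have FBt := filtration_mono st FB.
have FXs := filtration_mono st (@filtration_state s x).
have FI := salgI (filtration_algebra t).
rewrite ![B `&` C]setIC -![C `&` _ `&` _]setIA !ind; first last.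
- by apply: (FI) => //; apply: (FI) => //; exact: filtration_state.
- exact: FI.
by rewrite graph_markov// mulrCA.
Qed.

End graph_process.

(** * No strong stationary time beats the last first update *)

Section stationary_time_lower_bound.
Context {d : measure_display} {Omega : measurableType d} {R : realType}.
Variables (P : probability Omega R) (n : nat) (alpha beta : R).
Variables (tau : vpair n -> nat -> Omega -> R) (upd : vpair n -> nat -> Omega -> bool).
Variable x0 : graph_state n.
Hypothesis HER : dynamic_ER_updates P tau upd alpha beta.
Local Notation lambda := (edge_rate alpha beta n).
Local Notation p := (edge_prob alpha beta n).
Hypothesis lambda0 : 0 < lambda.
Hypothesis p01 : 0 < p < 1.
Local Notation pr := (rprob P).
Local Notation X := (dynamic_ER tau upd x0).
Local Notation F := (update_filtration tau upd).
Local Notation pi := (@erdos_renyi_pmf R n p).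

Let Ptau e := update_times HER e.

Variable T : Omega -> \bar R.
Hypothesis mT : measurable_fun setT T.
Hypothesis T0 : forall w, (0 <= T w)%E.
Variable G : set (set Omega).
Hypotheses (sG : sigma_algebra setT G) (mG : G `<=` measurable).
Hypothesis iG : independent P G (F_infty F).
Hypothesis FT : forall t : R, 0 <= t -> <<s F t `|` G >> [set w | (T w <= t%:E)%E].
Hypothesis sstT : forall (t : R) (y : graph_state n), 0 <= t ->
  pr [set w | (T w <= t%:E)%E /\ X (fine (T w)) w = y] =
  pr [set w | (T w <= t%:E)%E] * pi y.

Local Notation below t := [set w | (T w <= t%:E)%E].

Lemma measurable_fine_T : measurable_fun setT (fine \o T).
Proof. exact: measurableT_comp. Qed.

Lemma measurable_below t : measurable (below t).
Proof. by rewrite -[mkset _]setTI; exact: emeasurable_fun_infty_c. Qed.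

Lemma below_fine t w : (T w <= t%:E)%E = (T w < +oo)%E && (fine (T w) <= t).
Proof.
have := T0 w; case: (T w) => [r| |]//=; first by rewrite ltry lee_fin.
Qed.

(** The error event of rounding [T] up by at most [delta]: outside of it the
    state does not change in between ([state_right]). *)
Definition near_update (delta : R) : set Omega :=
  [set w | exists q : vpair n * nat,
     fine (T w) < tau q.1 q.2 w /\ tau q.1 q.2 w <= fine (T w) + delta].

Lemma measurable_near_update delta : measurable (near_update delta).
Proof.
apply: (salg_count (@sigma_algebra_measurable _ Omega)) => -[e k] /=.
have mtau := point_measurable (Ptau e) k.
apply: measurableI; first exact: measurable_lt_set measurable_fine_T mtau.
apply: measurable_le_set => //.
by apply: measurable_funD => //; exact: measurable_fine_T.
Qed.

Lemma state_right s delta w : fine (T w) <= s -> s <= fine (T w) + delta ->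
  ~ near_update delta w -> X s w = X (fine (T w)) w.
Proof.
move=> Ts sT nb; apply/ffunP => e; rewrite !ffunE.
suff -> : counting_process (tau e) s w = counting_process (tau e) (fine (T w)) w by [].
apply/eqP; rewrite eqn_leq (counting_mono (Ptau e) w Ts) andbT leqNgt.
apply/negP => lt; apply: nb; exists (e, counting_process (tau e) (fine (T w)) w) => /=.
split; last by rewrite (le_trans _ sT)// -(lt_counting (Ptau e)).
by rewrite ltNge -(lt_counting (Ptau e)) ltnn.
Qed.

(** For each pair the first update strictly after [T] comes after a positive
    delay, and there are finitely many pairs; so the events decrease to the
    empty set. *)
Lemma near_update_cvg0 : pr (near_update n.+1%:R^-1) @[n --> \oo] --> 0.
Proof.
have nonincr : nonincreasing_seq (fun m : nat => near_update m.+1%:R^-1).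
  move=> i j ij; apply/subsetPset => w [q [q1 q2]]; exists q; split => //.
  by rewrite (le_trans q2)// lerD2l lef_pV2 ?posrE// ler_nat.
have H0 : \bigcap_m near_update m.+1%:R^-1 = set0.
  apply/seteqP; split => // w H.
  pose K e := counting_process (tau e) (fine (T w)) w.
  have gap e : 0 < tau e (K e) w - fine (T w).
    by rewrite subr_gt0 ltNge -(lt_counting (Ptau e)) ltnn.
  have [m _ /(_ m (leqnn m)) Hm] : \forall m \near \oo, forall e : vpair n,
      (m.+1%:R^-1 : R) < tau e (K e) w - fine (T w).
    by apply: filter_forall => e; exact: near_infty_natSinv_lt (PosNum (gap e)).
  have [[e k] /= [q1 q2]] := H m I.
  have Kk : (K e <= k)%N by rewrite leqNgt (lt_counting (Ptau e)) -ltNge.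
  have := Hm e; rewrite ltNge => /negP; apply; rewrite lerBlDl.
  by apply: (le_trans _ q2); exact: (point_mono (Ptau e)).
have mB m := measurable_near_update m.+1%:R^-1.
have := @nonincreasing_cvg_mu _ _ _ P (fun m => near_update m.+1%:R^-1).
rewrite H0 measure0 => /(_ _ mB measurable0 nonincr) cv.
apply: fine_cvg; apply: cv.
by rewrite (le_lt_trans (probability_le1 P (mB 0%N)))// ltry.
Qed.

(** The contribution of one cell of the grid, where [A] is the event that
    [T] lies in the cell with right end [s].  The law of the state at [T] on [A]
    is stationary by assumption; up to the error event it is the law at [s], to
    which the Markov property applies; and the transition from [s] to [t]
    preserves the stationary law. *)
Lemma sst_cell_bound (A : set Omega) (s t delta : R) y :
  0 <= s -> s <= t -> <<s F s `|` G >> A -> A `<=` below s ->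
  (forall w, A w -> s <= fine (T w) + delta) ->
  (forall x, pr (A `&` [set w | X (fine (T w)) w = x]) = pr A * pi x) ->
  (forall x, measurable (A `&` [set w | X (fine (T w)) w = x])) ->
  pi y * pr A <= pr (A `&` [set w | X t w = y]) + pr (A `&` near_update delta).
Proof.
move=> s0 st sA As Ad Ax mAx.
have mk x := graph_markov_randomized x0 HER lambda0 x y sG mG iG s0 st sA.
have mA : measurable A := (mk x0).1.
have mXs x := measurable_state x0 HER s x.
have mXt := measurable_state x0 HER t y.
have mB := measurable_near_update delta.
have st0 : 0 <= t - s by rewrite subr_ge0.
pose q x := graph_transition lambda p (t - s) x y.
have q0 x : 0 <= q x by exact: graph_transition_ge0.
have q1 x : q x <= 1 by exact: graph_transition_le1.
rewrite -(erdos_renyi_invariant lambda p (t - s) y) mulr_suml.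
have -> : pr (A `&` [set w | X t w = y]) = \sum_x q x * pr (A `&` [set w | X s w = x]).
  rewrite -(pr_fin_partition P _ mXs); last exact: measurableI.
  apply: eq_bigr => x _; rewrite -(mk x).2 -setIA; congr (pr (_ `&` _)).
  exact: setIC.
set AB := A `&` near_update delta.
have mAB : measurable AB by exact: measurableI.
have ABAx x : pr (AB `&` [set w | X (fine (T w)) w = x]) =
    pr (A `&` [set w | X (fine (T w)) w = x] `&` near_update delta).
  by rewrite /AB setIAC.
have -> : pr AB = \sum_x pr (A `&` [set w | X (fine (T w)) w = x] `&` near_update delta).
  (* The state at [T] is only known to be measurable on [A]; the value [x0]
     elsewhere turns it into a finite-valued measurable function. *)
  pose f w := if pselect (A w) is left _ then X (fine (T w)) w else x0.
  have mf x : measurable [set w | f w = x].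
    rewrite (_ : mkset _ = (A `&` [set w | X (fine (T w)) w = x]) `|`
        (~` A `&` (if x0 == x then setT else set0))).
      apply: measurableU => //; apply: measurableI; first exact: measurableC.
      by case: ifP.
    apply/seteqP; split => w; rewrite /= /f; case: pselect => Aw.
    - by left.
    - by move=> ->; right; rewrite eqxx.
    - by case=> [[]|[]].
    - by case=> [[]|[_]] //; case: eqP.
  rewrite -(pr_fin_partition P mAB mf); apply: eq_bigr => x _; congr (pr _).
  rewrite /AB /f; apply/seteqP; split => w /=.
    by move=> [[Aw nw]]; case: pselect.
  by move=> [[Aw Xw] nw]; split => //; case: pselect.
rewrite -big_split /=; apply: ler_sum => x _.
rewrite -/(q x) -mulrA [q x * _]mulrC mulrA [pi x * _]mulrC -Ax.
have mAxB : measurable (A `&` [set w | X (fine (T w)) w = x] `&` near_update delta).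
  exact: measurableI.
have : pr (A `&` [set w | X (fine (T w)) w = x]) <=
   pr (A `&` [set w | X s w = x]) +
   pr (A `&` [set w | X (fine (T w)) w = x] `&` near_update delta).
  rewrite (pr_split P (mAx x) mB) addrC lerD2r; apply: le_pr.
  - by apply: measurableI => //; exact: measurableC.
  - exact: measurableI.
  - move=> w [[Aw <-] nb]; split => //=; apply: state_right nb; last exact: Ad.
    by have := As _ Aw; rewrite /= below_fine => /andP[].
move=> /(ler_wpM2r (q0 x))/le_trans; apply.
rewrite mulrDl [q x * _]mulrC lerD2l ler_piMr//; exact: pr_ge0.
Qed.

Lemma measurable_below_state t x :
  measurable (below t `&` [set w | X (fine (T w)) w = x]).
Proof.
apply: measurableI; first exact: measurable_below.
have -> : [set w | X (fine (T w)) w = x] = \bigcap_e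
  [set w | (if counting_process (tau e) (fine (T w)) w is k.+1 then upd e k w else x0 e) = x e].
  apply/seteqP; split => [w /= <- e _|w Xw] /=; first by rewrite ffunE.
  by apply/ffunP => e; rewrite ffunE Xw.
have sm := @sigma_algebra_measurable _ Omega.
apply: (salg_bigcap_fin sm) => e.
have mN : forall j, measurable [set w | counting_process (tau e) (fine (T w)) w = j].
  apply: (salg_nat_eq sm) => k.
  rewrite (_ : mkset _ = [set w | tau e k w <= fine (T w)]); last first.
    by apply/seteqP; split => w /=; rewrite (lt_counting (Ptau e)).
  apply: measurable_le_set measurable_fine_T; exact: (point_measurable (Ptau e)).
rewrite (_ : mkset _ = [set w | exists j,
   ([set w | counting_process (tau e) (fine (T w)) w = j] `&`
    [set w | (if j is k.+1 then upd e k w else x0 e) = x e]) w]).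
  apply: (salg_count sm) => j; apply: measurableI => //.
  case: j => [|k].
    have [->|/eqP xx] := eqVneq (x0 e) (x e).
      by rewrite (_ : mkset _ = setT)//; apply/seteqP; split.
    by rewrite (_ : mkset _ = set0)//; apply/seteqP; split.
  exact: (measurable_upd (Ptau e) (update_measurable HER e) k [set x e]).
apply/seteqP; split => w /=; last by move=> [j [-> ]].
by move=> H; exists (counting_process (tau e) (fine (T w)) w).
Qed.

(** Summation of [sst_cell_bound] over the cells, as an induction on the
    number of cells.  The last cell is cut off at [t], so that the grid ends
    exactly there. *)
Lemma sst_grid_bound (t : R) (m : nat) y : 0 <= t -> forall (j : nat) (s : R),
  s = Num.min t (j%:R / m.+1%:R) ->
  pi y * pr (below s) <=
  pr (below s `&` [set w | X t w = y]) + pr (below s `&` near_update m.+1%:R^-1).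
Proof.
move=> t0; have mXt := measurable_state x0 HER t y.
have mB := measurable_near_update m.+1%:R^-1.
elim=> [|j IH] s sE.
  have -> : s = 0 by rewrite sE mul0r; apply/min_idPr.
  apply: (@sst_cell_bound _ 0) => //.
  - exact: FT.
  - move=> w _; rewrite addr_ge0 ?invr_ge0//; exact: fine_ge0.
  - by move=> x; rewrite -sstT.
  - by move=> x; exact: measurable_below_state.
set r := Num.min t (j%:R / m.+1%:R) in IH; have {}IH := IH r erefl.
have r0 : 0 <= r by rewrite le_min t0 divr_ge0.
have rs : r <= s.
  by rewrite /r sE le_min ge_min lexx /= ge_min ler_pM2r ?invr_gt0// ler_nat leqnSn orbT.
have s0 : 0 <= s := le_trans r0 rs.
have stt : s <= t by rewrite sE ge_min lexx.
have sr : s <= r + m.+1%:R^-1.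
  rewrite /r sE addr_minl le_min !ge_min; apply/andP; split; apply/orP.
    by left; rewrite lerDl invr_ge0.
  by right; rewrite -natr1 mulrDl mul1r.
pose A := below s `\` below r.
have brs : below r `<=` below s.
  by move=> w /= Tr; apply: (le_trans Tr); rewrite lee_fin.
have mbr := measurable_below r; have mbs := measurable_below s.
have mA : measurable A by exact: measurableD.
have dec (D : set Omega) : measurable (below s `&` D) -> measurable (below r `&` D) ->
    pr (below s `&` D) = pr (below r `&` D) + pr (A `&` D).
  move=> ms mr; rewrite (pr_split P ms mbr) [RHS]addrC [LHS]addrC; congr (pr _ + pr _).
    by rewrite /A setDE setIAC.
  apply/seteqP; split => w; first by move=> [[_ Dw] br].
  by move=> [br Dw]; split => //; split => //; exact: brs.
have dT : pr (below s) = pr (below r) + pr A.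
  by have := dec setT; rewrite !setIT; apply.
have step : pi y * pr A <=
    pr (A `&` [set w | X t w = y]) + pr (A `&` near_update m.+1%:R^-1).
  apply: (@sst_cell_bound _ s) => //.
  - apply: (salgI (@smallest_sigma_algebra _ setT _)); first exact: FT.
    apply: (salgC (@smallest_sigma_algebra _ setT _)).
    have : <<s F r `|` G >> (below r) by exact: FT.
    by apply: sub_sigma_algebra2; apply: setSU; exact: filtration_mono.
  - by move=> w [].
  - move=> w [bs /=]; rewrite below_fine => /negP; rewrite negb_and => /orP[|].
      by move: bs; rewrite /= below_fine => /andP[->].
    by rewrite -ltNge => rT; rewrite (le_trans sr)// lerD2r ltW.
  - move=> x; have ms := measurable_below_state s x; have mr := measurable_below_state r x.
    apply: (addrI (pr (below r `&` [set w | X (fine (T w)) w = x]))).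
    rewrite -dec//; have := sstT x s0; have := sstT x r0.
    rewrite /setI /= => -> ->; rewrite -mulrDl; congr (_ * _); exact: dT.
  - move=> x; rewrite /A setDE setIAC -setDE; apply: measurableD => //.
    exact: measurable_below_state.
rewrite dT mulrDr (dec [set w | X t w = y]) ?(dec (near_update _)); try exact: measurableI.
rewrite (le_trans (lerD IH step))//.
by rewrite addrACA.
Qed.

Lemma sst_law_bound (t : R) y : 0 <= t -> pi y * pr (below t) <= pr [set w | X t w = y].
Proof.
move=> t0; have mXt := measurable_state x0 HER t y; have mb := measurable_below t.
have H m : pi y * pr (below t) - pr [set w | X t w = y] <= pr (near_update m.+1%:R^-1).
  have [j Hj] : exists j : nat, t * m.+1%:R <= j%:R.
    exists (Num.bound (t * m.+1%:R)); apply/ltW/archi_boundP.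
    by rewrite mulr_ge0.
  have := @sst_grid_bound _ m y t0 j _ erefl.
  have -> : Num.min t (j%:R / m.+1%:R) = t.
    by apply/min_idPl; rewrite ler_pdivlMr.
  move=> /le_trans h; rewrite lerBlDl; apply: h.
  have mB := measurable_near_update m.+1%:R^-1.
  apply: lerD; apply: le_pr => //; 
    try exact: measurableI; exact: subIsetr.
rewrite -subr_le0; apply: (cvgr_to_ge near_update_cvg0).
by apply: nearW => m; exact: H.
Qed.

End stationary_time_lower_bound.

(** * The last first update is a strong stationary time *)

Section last_first_update.
Context {d : measure_display} {Omega : measurableType d} {R : realType}.
Variables (P : probability Omega R) (n : nat) (alpha beta : R).
Variables (tau : vpair n -> nat -> Omega -> R) (upd : vpair n -> nat -> Omega -> bool).
Variable x0 : graph_state n.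
Hypothesis HER : dynamic_ER_updates P tau upd alpha beta.
Local Notation lambda := (edge_rate alpha beta n).
Local Notation p := (edge_prob alpha beta n).
Hypothesis lambda0 : 0 < lambda.
Hypothesis p01 : 0 < p < 1.
Local Notation pr := (rprob P).
Local Notation X := (dynamic_ER tau upd x0).
Local Notation F := (update_filtration tau upd).
Local Notation pi := (@erdos_renyi_pmf R n p).

Let Ptau e := update_times HER e.
Let mupd e := update_measurable HER e.

(** The points are positive, so the neutral value 0 only matters when there
    are no pairs at all. *)
Definition full_update_time (w : Omega) : R := \big[Num.max/0]_(e : vpair n) tau e 0%N w.

Lemma first_update_le_full e w : tau e 0%N w <= full_update_time w.
Proof. exact: le_bigmax. Qed.

Lemma full_update_time_ge0 w : 0 <= full_update_time w.
Proof. by apply: bigmax_ge_id. Qed.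

Lemma full_update_time_le t w : 0 <= t ->
  (full_update_time w <= t) <-> (forall e, tau e 0%N w <= t).
Proof.
move=> t0; split => [Mt e|H]; first exact: le_trans (first_update_le_full e w) Mt.
by apply/bigmax_leP; split.
Qed.

Lemma full_update_time_leE t : 0 <= t ->
  [set w | full_update_time w <= t] = \bigcap_e [set w | tau e 0%N w <= t].
Proof.
move=> t0; apply/seteqP; split => w.
  by move=> /(full_update_time_le w t0) H e _; exact: H.
by move=> H; apply/(full_update_time_le w t0) => e; exact: H.
Qed.

Lemma le_full_update_time e k w : tau e k w <= full_update_time w <->
  exists e', tau e k w <= tau e' 0%N w.
Proof.
split => [|[e' /le_trans]]; last by apply; exact: first_update_le_full.
move=> ke; apply: contrapT => /forallNP H.
suff : full_update_time w < tau e k w by rewrite ltNge ke.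
apply/bigmax_ltP; split.
  by rewrite (lt_le_trans (point_gt0 (Ptau e) w))// (point_mono (Ptau e)).
by move=> e' _; rewrite ltNge; apply/negP; exact: H.
Qed.

Definition times_rectangles : set (set Omega) :=
  [set A | exists2 B : vpair n -> set Omega,
     (forall e, sigma_seq (tau e) (B e)) & A = \bigcap_e B e].

Definition times_sigma : set (set Omega) := <<s times_rectangles >>.

Lemma times_sigma_algebra : sigma_algebra setT times_sigma.
Proof. exact: smallest_sigma_algebra. Qed.

Lemma times_sigma_edge e A : sigma_seq (tau e) A -> times_sigma A.
Proof.
move=> sA; apply: sub_sigma_algebra.
exists (fun e' => if e' == e then A else setT).
  by move=> e'; case: eqP => [->//|_]; exact: (salgT (sigma_seq_algebra _)).
apply/seteqP; split => w; first by move=> Aw e' _; case: eqP.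
by move=> /(_ e I); rewrite eqxx.
Qed.

Lemma times_sigma_point e k r : times_sigma [set w | tau e k w <= r].
Proof.
apply: (@times_sigma_edge e); apply: sub_sigma_algebra; exists k => //.
exists `]-oo, r]%classic; first exact: measurable_itv.
by rewrite setTI; apply/seteqP; split => w /=; rewrite in_itv.
Qed.

Lemma times_sigma_full t : 0 <= t -> times_sigma [set w | full_update_time w <= t].
Proof.
move=> t0; rewrite full_update_time_leE//; apply: (salg_bigcap_fin times_sigma_algebra).
by move=> e; exact: times_sigma_point.
Qed.

(** The number of updates of each pair by the time of the last first update;
    the last of these updates is the one whose outcome is seen then. *)
Definition counts (w : Omega) : {ffun vpair n -> nat} :=
  [ffun e => counting_process (tau e) (full_update_time w) w].

Lemma times_sigma_counts kappa : times_sigma [set w | counts w = kappa].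
Proof.
have -> : [set w | counts w = kappa] =
    \bigcap_e [set w | counting_process (tau e) (full_update_time w) w = kappa e].
  apply/seteqP; split => [w /= <- e _|w Kw] /=; first by rewrite ffunE.
  by apply/ffunP => e; rewrite ffunE Kw.
apply: (salg_bigcap_fin times_sigma_algebra) => e.
apply: (salg_nat_eq times_sigma_algebra) => k.
rewrite (_ : mkset _ = [set w | exists e', (~` [set w | tau e' 0%N w < tau e k w]) w]).
  apply: (salg_count times_sigma_algebra) => e'; apply: (salgC times_sigma_algebra).
  by apply: (salg_lt times_sigma_algebra) => r; exact: times_sigma_point.
apply/seteqP; split => w /=; rewrite (lt_counting (Ptau e)).
  by move=> /le_full_update_time[e' h]; exists e'; apply/negP; rewrite -leNgt.
by move=> [e' /negP]; rewrite -leNgt => h; apply/le_full_update_time; exists e'.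
Qed.

(** Whichever update is selected for each pair, as long as the choice is
    fixed, the outcomes are independent coins and independent of all update
    times. *)
Lemma times_sigma_upd_indep (kappa : vpair n -> nat) (y : graph_state n) A :
  times_sigma A ->
  measurable A /\
  pr (A `&` \bigcap_e [set w | upd e (kappa e) w = y e]) = pi y * pr A.
Proof.
pose V e := [set w | upd e (kappa e) w = y e].
have sV e : edge_sigma (tau e) (upd e) (V e).
  exact: (@edge_sigma_upd _ _ _ (tau e) (upd e) (kappa e) [set y e]).
have sT e B : sigma_seq (tau e) B -> edge_sigma (tau e) (upd e) B.
  by move=> sB; apply: sub_sigma_algebra; left.
have mV : measurable (\bigcap_e V e).
  apply: (salg_bigcap_fin (@sigma_algebra_measurable _ Omega)) => e.
  exact: (edge_sigma_measurable (Ptau e) (mupd e)).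
move=> sA; rewrite -[in X in _ /\ _ = X](setIT A).
apply: (pi_lambda_pr _ _ _ mV measurableT _ sA).
- move=> _ _ [B1 pB1 ->] [B2 pB2 ->]; exists (fun e => B1 e `&` B2 e).
    by move=> e; apply: (salgI (sigma_seq_algebra _)).
  by rewrite bigcapI.
- exists (fun=> setT); first by move=> e; exact: (salgT (sigma_seq_algebra _)).
  by apply/seteqP; split.
- move=> _ [B sB ->]; apply: (salg_bigcap_fin (@sigma_algebra_measurable _ Omega)) => e.
  exact: (sigma_seq_measurable (Ptau e)).
move=> _ [B sB ->]; rewrite setIT -bigcapI !(pr_edge_prod HER); first last.
- by move=> e; apply: (salgI (edge_sigma_algebra _ _)) => //; exact: sT.
- by move=> e; exact: sT.
rewrite /erdos_renyi_pmf -big_split /=; apply: eq_bigr => e _.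
have nK : kappa e \notin (fset0 : {fset nat}) by rewrite in_fset0.
have := upd_indep (Ptau e) (mupd e) (update_independent HER (e := e)) (fun=> setT)
  [set y e] (sB e) nK.
rewrite /= (_ : mkset (fun w => forall k', _ -> _) = setT); last first.
  by apply/seteqP; split.
rewrite pr_setT mulr1 setTI => ->.
by rewrite (pr_upd (Ptau e) (mupd e) (update_law HER e)) mulrC.
Qed.

(** The factor of a pair is the probability that its counting process has
    left 0 by time [t]. *)
Lemma pr_full_update_time t : 0 <= t ->
  pr [set w | full_update_time w <= t] = (1 - expR (- (lambda * t))) ^+ #|{: vpair n}|.
Proof.
move=> t0; rewrite full_update_time_leE// (pr_edge_prod HER); last first.
  move=> e; apply: sub_sigma_algebra; left.
  rewrite (_ : mkset _ = ~` [set w | counting_process (tau e) t w = 0%N]).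
    by apply: (salgC (sigma_seq_algebra _)); exact: (sigma_seq_counting (Ptau e)).
  apply/seteqP; split => w /=; rewrite -(lt_counting (Ptau e)).
    by case: (counting_process _ _ _).
  by case: (counting_process _ _ _).
rewrite -prodr_const; apply: eq_bigr => e _.
rewrite (_ : mkset _ = ~` [set w | counting_process (tau e) t w = 0%N]); last first.
  apply/seteqP; split => w /=; rewrite -(lt_counting (Ptau e)).
    by case: (counting_process _ _ _).
  by case: (counting_process _ _ _).
rewrite prC; last exact: (measurable_counting (Ptau e) (mupd e)).
congr (1 - _); move: t0; rewrite le_eqVlt => /orP[/eqP <-|t0].
  rewrite mulr0 oppr0 expR0 (_ : mkset _ = setT) ?pr_setT//.
  by apply/seteqP; split => // w _ /=; rewrite (counting_le0 (Ptau e)).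
have := poisson_increment (Ptau e) 0%N (lexx 0) t0.
rewrite /poisson_pmf subr0 mulr_gt0// expr0 fact0 invr1 !mul1r.
rewrite (_ : mkset _ = [set w | counting_process (tau e) t w = 0%N]).
  by move=> H; rewrite /rprob H.
by apply/seteqP; split => w /=; rewrite (counting_le0 (Ptau e) w (lexx 0)) subn0.
Qed.

Lemma measurable_full_update_time : measurable_fun setT full_update_time.
Proof.
rewrite /full_update_time; elim: (index_enum _) => [|e l IH].
  by under eq_fun do rewrite big_nil; exact: measurable_cst.
under eq_fun do rewrite big_cons.
by apply: measurable_maxr => //; exact: (point_measurable (Ptau e)).
Qed.

Lemma filtration_full_update_time t : 0 <= t -> F t [set w | full_update_time w <= t].
Proof.
move=> t0; rewrite full_update_time_leE//; apply: (salg_bigcap_fin (filtration_algebra _ _ t)).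
move=> e; apply: (@edge_past_filtration _ _ _ _ tau upd e).
rewrite (_ : mkset _ = [set w | (0 < counting_process (tau e) t w)%N]).
  exact: (edge_past_lt_counting (Ptau e)).
by apply/seteqP; split => w /=; rewrite (lt_counting (Ptau e)).
Qed.

(** The counts at the last first update are functions of the update times.
    Conditioning on them selects a fixed update for each pair, and
    [times_sigma_upd_indep] gives the stationary weight for every value of the
    counts. *)
Lemma pr_full_update_state t y : 0 <= t ->
  pr [set w | full_update_time w <= t /\ X (full_update_time w) w = y] =
  pi y * pr [set w | full_update_time w <= t].
Proof.
move=> t0.
have mtimes A : times_sigma A -> measurable A.
  by move=> sA; exact: (times_sigma_upd_indep (fun=> 0%N) x0 sA).1.
have mK kappa : measurable [set w | counts w = kappa].
  by apply: mtimes; exact: times_sigma_counts.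
have mM : measurable [set w | full_update_time w <= t].
  by apply: mtimes; exact: times_sigma_full.
have setE kappa : [set w | full_update_time w <= t /\ X (full_update_time w) w = y] `&`
    [set w | counts w = kappa] =
    ([set w | full_update_time w <= t] `&` [set w | counts w = kappa]) `&`
    \bigcap_e [set w | upd e (kappa e).-1 w = y e].
  (* Every pair has been updated by then, so the initial state is forgotten. *)
  have cpos e w : exists k, counts w e = k.+1.
    have : (0 < counts w e)%N.
      by rewrite ffunE (lt_counting (Ptau e)) first_update_le_full.
    by case: (counts w e) => // k _; exists k.
  apply/seteqP; split => w /=.
    move=> [[Mt Xy] Kw]; split => // e _ /=; rewrite -Kw -Xy !ffunE.
    by have := cpos e w; rewrite ffunE => -[k ->].
  move=> [[Mt Kw] Uw]; split => //; split => //; apply/ffunP => e.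
  have := Uw e I; rewrite /= -Kw !ffunE => <-.
  by have := cpos e w; rewrite ffunE => -[k ->].
have sMK kappa : times_sigma ([set w | full_update_time w <= t] `&` [set w | counts w = kappa]).
  apply: (salgI times_sigma_algebra); first exact: times_sigma_full.
  exact: times_sigma_counts.
apply: (pr_partition_count mK) => //.
  rewrite (_ : mkset _ = [set w | exists kappa,
     ([set w | full_update_time w <= t /\ X (full_update_time w) w = y] `&`
      [set w | counts w = kappa]) w]); last first.
    by apply/seteqP; split => w /=; [exists (counts w)|case=> ? []].
  apply: (salg_count (@sigma_algebra_measurable _ Omega)) => kappa; rewrite setE.
  apply: measurableI; first exact: mtimes.
  apply: (salg_bigcap_fin (@sigma_algebra_measurable _ Omega)) => e.
  exact: (measurable_upd (Ptau e) (mupd e) _ [set y e]).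
by move=> kappa; rewrite setE (times_sigma_upd_indep _ _ (sMK kappa)).2.
Qed.

Lemma full_update_time_sst :
  strong_stationary_time P F X pi (fun w => (full_update_time w)%:E).
Proof.
have fin : [set w | ((full_update_time w)%:E < +oo)%E] = setT.
  by apply/seteqP; split => w //= _; rewrite ltry.
split; last first.
  move=> t y t0; rewrite /cond_prob fin !setIT probability_setT !divr1.
  rewrite mulrC; exact: pr_full_update_state.
(* A stopping time of the filtration itself: the randomization is trivial. *)
have sG : sigma_algebra setT [set A : set Omega | A = set0 \/ A = setT].
  split; first by left.
    by move=> A [->|->]; [right; rewrite setD0|left; rewrite setDT].
  move=> A HA; have [[k Ak]|nk] := pselect (exists k, A k = setT).
    by right; apply/seteqP; split => // w _; exists k; rewrite ?Ak.
  left; apply/seteqP; split => // w [k _]; case: (HA k) => [->//|Ak].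
  by exfalso; apply: nk; exists k.
split.
- by apply/measurable_EFinP; exact: measurable_full_update_time.
- by move=> w; rewrite lee_fin full_update_time_ge0.
exists [set A : set Omega | A = set0 \/ A = setT]; split => //.
- by move=> A [->|->].
- move=> A B [->|->] _; first by rewrite set0I measure0 mul0e.
  by rewrite setTI probability_setT mul1e.
- move=> t t0; apply: sub_sigma_algebra; left.
  by under eq_set do rewrite lee_fin; exact: filtration_full_update_time.
Qed.

(** The lower bound compares [T] with [full_update_time]; the upper bound
    is [sst_law_bound] at the complement of the initial state, whose stationary
    weight cancels. *)
Lemma fastest_time_law (T : Omega -> \bar R) t :
  fastest_time_to_stationarity P F X pi T -> 0 <= t ->
  P [set w | (T w <= t%:E)%E] = ((1 - expR (- (lambda * t))) ^+ #|{: vpair n}|)%:E.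
Proof.
move=> [[[mT T0 [G [sG mG iG FT]]] sst] fast].
have mb r : measurable [set w | (T w <= r%:E)%E].
  by rewrite -[mkset _]setTI; exact: emeasurable_fun_infty_c.
have low r : 0 <= r ->
    (1 - expR (- (lambda * r))) ^+ #|{: vpair n}| <= pr [set w | (T w <= r%:E)%E].
  move=> r0; rewrite -pr_full_update_time//.
  have mM : measurable [set w | full_update_time w <= r].
    by apply: (@filtration_measurable _ _ _ _ _ _ _ _ _ HER r); exact: filtration_full_update_time.
  have := fast _ full_update_time_sst r.
  have -> : [set w | (r%:E < T w)%E] = ~` [set w | (T w <= r%:E)%E].
    by apply/seteqP; split => w /=; rewrite ltNge => /negP.
  have -> : [set w | (r%:E < (full_update_time w)%:E)%E] = ~` [set w | full_update_time w <= r].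
    by apply/seteqP; split => w /=; rewrite ltNge lee_fin => /negP.
  rewrite !prE ?lee_fin; try exact: measurableC.
  by rewrite !prC// lerD2l lerN2.
(* The defining identity of a strong stationary time is conditional on
   finiteness of [T], and is only informative once this has positive
   probability. *)
have Toopos : 0 < fine (P [set w | (T w < +oo)%E]).
  have := low 1 ler01; have mo : measurable [set w | (T w < +oo)%E].
    by rewrite -[mkset _]setTI; exact: emeasurable_fun_infty_o.
  have /(le_pr P (mb 1) mo) h : [set w | (T w <= 1%:E)%E] `<=` [set w | (T w < +oo)%E].
    by move=> w /= /le_lt_trans; apply; rewrite ltry.
  move=> /le_trans /(_ h); apply: lt_le_trans; apply: exprn_gt0.
  by rewrite mulr1 subr_gt0 -[ltRHS]expR0 ltr_expR oppr_lt0.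
have sstT r y : 0 <= r ->
    pr [set w | (T w <= r%:E)%E /\ X (fine (T w)) w = y] =
    pr [set w | (T w <= r%:E)%E] * pi y.
  move=> r0; have := sst r y r0; rewrite /cond_prob.
  have sub (A : set Omega) : A `<=` [set w | (T w <= r%:E)%E] ->
      A `&` [set w | (T w < +oo)%E] = A.
    by move=> Ar; apply/setIidPl => w /Ar /le_lt_trans; apply; rewrite ltry.
  rewrite !sub//; last by move=> w [].
  rewrite mulrAC => /(mulIf _); apply; by rewrite invr_eq0 gt_eqF.
move=> t0; rewrite prE//; congr EFin; apply: le_anti; rewrite low// andbT.
pose y : graph_state n := [ffun e => ~~ x0 e].
have piy := erdos_renyi_pmf_gt0 p01 y.
rewrite -(ler_pM2l piy) [leRHS]mulrC.
rewrite -graph_transition_flip -/y.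
have := sst_law_bound HER lambda0 p01 mT T0 sG mG iG FT sstT y t0.
move=> /le_trans; apply.
have := graph_markov x0 HER lambda0 x0 y (lexx 0) t0 (salgT (filtration_algebra tau upd 0)).
have -> : [set w | X 0 w = x0] = setT.
  apply/seteqP; split => // w _ /=; apply/ffunP => e.
  by rewrite ffunE (counting_le0 (Ptau e)).
by rewrite !setTI pr_setT mulr1 subr0 => ->.
Qed.

End last_first_update.

(** * The Gumbel limit *)

Section limits.
Context {R : realType}.

(** Both bounds are [1 + x <= exp x], at [x = - a] and at
    [x = a / (1 - a)]. *)
Lemma exprn_expR_bounds (a : R) (N : nat) : 0 <= a < 1 ->
  expR (- (N%:R * a / (1 - a))) <= (1 - a) ^+ N <= expR (- (N%:R * a)).
Proof.
move=> /andP[a0 a1]; have b0 : 0 < 1 - a by rewrite subr_gt0.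
apply/andP; split; last first.
  rewrite -mulrN expRM_natl; apply: lerXn2r; rewrite ?nnegrE ?expR_ge0 ?(ltW b0)//.
  exact: expR_ge1Dx.
rewrite -mulrA -mulrN expRM_natl; apply: lerXn2r; rewrite ?nnegrE ?expR_ge0 ?(ltW b0)//.
rewrite expRN -[leRHS]invrK lef_pV2 ?posrE ?expR_gt0 ?invr_gt0//.
apply: le_trans (expR_ge1Dx _).
rewrite (_ : 1 + a / (1 - a) = (1 - a)^-1)//; field; exact: lt0r_neq0.
Qed.

Lemma cvg_exprn_expR (a : nat -> R) (N : nat -> nat) (c : R) :
  (\forall m \near \oo, 0 <= a m) -> a m @[m --> \oo] --> 0 ->
  (N m)%:R * a m @[m --> \oo] --> c ->
  (1 - a m) ^+ N m @[m --> \oo] --> expR (- c).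
Proof.
move=> a0 ca cNa.
apply: (squeeze_cvgr (f := fun m => expR (- ((N m)%:R * a m / (1 - a m))))
  (h := fun m => expR (- ((N m)%:R * a m)))).
- near=> m; apply: exprn_expR_bounds; apply/andP; split; first by near: m.
  by near: m; apply: (cvgr_lt _ ca); exact: ltr01.
- apply: continuous_cvg; first exact: continuous_expR.
  apply: cvgN; rewrite -[X in _ --> X]mulr1; apply: cvgM => //.
  rewrite -[X in _ --> X]invr1; apply: cvgV; first exact: oner_neq0.
  by rewrite -[X in _ --> X]subr0; apply: cvgB => //; exact: cvg_cst.
- apply: continuous_cvg; first exact: continuous_expR.
  exact: cvgN.
Unshelve. all: by end_near. Qed.

(** Comparing with the square root is enough for [ln m / m] to vanish. *)
Lemma ln_natS_le (m : nat) : ln m.+1%:R <= 2 * Num.sqrt m.+1%:R :> R.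
Proof.
set s := Num.sqrt _; have s0 : 0 < s by rewrite sqrtr_gt0.
rewrite -[m.+1%:R]sqr_sqrtr// -/s lnXn// -[ln s *+ 2]mulr_natl ler_pM2l//.
exact/ltW/ln_sublinear.
Qed.

Lemma cvg_ln_div (x : R) :
  (x + 2 * ln m.+1%:R) / m%:R @[m --> \oo] --> (0 : R).
Proof.
have zs : (harmonic m : R) @[m --> \oo] --> (0 : R) by exact: cvg_harmonic.
have ss : Num.sqrt (harmonic m : R) @[m --> \oo] --> (0 : R).
  rewrite -[X in _ --> X](@sqrtr0 R); apply: continuous_cvg zs; exact: sqrt_continuous.
(* From [1 / m <= 2 / (m + 1)] and [ln (m + 1) <= 2 sqrt (m + 1)]. *)
pose g (m : nat) : R := 2 * `|x| * harmonic m + 8 * Num.sqrt (harmonic m).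
have gs : g m @[m --> \oo] --> (0 : R).
  rewrite -[X in _ --> X](addr0 (0 : R)); apply: cvgD.
    by rewrite -[X in _ --> X](mulr0 (2 * `|x|)); exact: cvgMr.
  by rewrite -[X in _ --> X](mulr0 (8 : R)); exact: cvgMr.
apply: (squeeze_cvgr (f := fun m => - g m) (h := g)) => //; last first.
  by rewrite -[X in _ --> X]oppr0; exact: cvgN.
exists 1%N => // m /= m1; rewrite -ler_norml.
have m0 : 0 < m%:R :> R by rewrite ltr0n.
have l0 : 0 <= ln m.+1%:R :> R by apply: ln_ge0; rewrite ler1n.
rewrite normrM normfV (gtr0_norm m0) ler_pdivrMr//.
apply: (le_trans (ler_normD _ _)); rewrite (ger0_norm (mulr_ge0 _ l0))//.
have hm : 1 <= 2 * harmonic m * m%:R :> R.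
  rewrite /harmonic mulrAC ler_pdivlMr// mul1r -natrM ler_nat.
  by rewrite mul2n -addnn -addn1 leq_add2l.
have sm : Num.sqrt (m.+1%:R : R) <= 2 * Num.sqrt (harmonic m) * m%:R.
  set s := Num.sqrt (m.+1%:R : R); have s0 : 0 < s by rewrite sqrtr_gt0.
  have -> : Num.sqrt (harmonic m : R) = s * harmonic m.
    by rewrite /harmonic sqrtrV// -/s -[X in _ / X](@sqr_sqrtr _ m.+1%:R)// -/s; field;
       rewrite lt0r_neq0.
  by rewrite -{1}[s]mulr1 [leRHS](_ : _ = s * (2 * harmonic m * m%:R)) ?ler_pM2l//; ring.
have h1 : `|x| * 1 <= `|x| * (2 * harmonic m * m%:R) by exact: ler_wpM2l.
have h2 := ln_natS_le m.
by rewrite /g; lra.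
Qed.

(** The number of pairs times the probability that one pair is still without
    update tends to [exp (- x)]; the correction of the rate by
    [beta / (n - 1)] contributes the factor [exp (- eps m)], which tends to 1. *)
Lemma gumbel_limit (alpha beta x : R) : 0 < alpha ->
  (1 - expR (- (edge_rate alpha beta n *
       ((x + 2 * ln n%:R - ln 2) / alpha)))) ^+ 'C(n, 2) @[n --> \oo]
  --> expR (- expR (- x)).
Proof.
move=> al0; rewrite -cvg_shiftS /=.
pose eps (m : nat) : R := beta / alpha * ((x - ln 2 + 2 * ln m.+1%:R) / m%:R).
have ceps : eps m @[m --> \oo] --> (0 : R).
  by rewrite -[X in _ --> X](mulr0 (beta / alpha)); apply: cvgMr; exact: cvg_ln_div.
have ce : expR (- eps m) @[m --> \oo] --> (1 : R).
  rewrite -expR0 -oppr0; apply: continuous_cvg; first exact: continuous_expR.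
  exact: cvgN.
have cz : (harmonic m : R) @[m --> \oo] --> (0 : R) by exact: cvg_harmonic.
pose a (m : nat) : R := expR (- (edge_rate alpha beta m.+1 *
       ((x + 2 * ln m.+1%:R - ln 2) / alpha))).
have aE m : a m = expR (- x) * 2 * harmonic m ^+ 2 * expR (- eps m).
  have al : alpha != 0 by rewrite gt_eqF.
  rewrite /a /edge_rate /=.
  rewrite (_ : - _ = - x + ln 2 + (- ln m.+1%:R - ln m.+1%:R) + - eps m); last first.
    rewrite /eps; set z := m%:R^-1; set l := ln m.+1%:R; set l2 := ln 2.
    by field.
  rewrite !expRD [expR (ln 2)]lnK ?posrE// [expR (- ln _)]expRN lnK ?posrE//.
apply: (@cvg_exprn_expR a (fun m => 'C(m.+1, 2))).
- by apply: nearW => m; exact: expR_ge0.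
- rewrite (_ : a = fun m => expR (- x) * 2 * harmonic m ^+ 2 * expR (- eps m)); last exact/funext.
  rewrite -[X in _ --> X](_ : expR (- x) * 2 * 0 ^+ 2 * 1 = 0); last by ring.
  apply: cvgM => //; apply: cvgMr; rewrite expr2; exact: cvgM.
rewrite (_ : (fun m => _) = fun m => (1 - harmonic m) * expR (- x) * expR (- eps m)).
  rewrite -[X in _ --> X]mulr1; apply: cvgM => //; rewrite -[X in _ --> X]mul1r.
  apply: cvgMl; rewrite -[X in _ --> X]subr0; apply: cvgB => //; exact: cvg_cst.
apply/funext => m; rewrite aE.
have C2 : 2 * ('C(m.+1, 2))%:R = m.+1%:R * m%:R :> R.
  by rewrite -!natrM -(mul_bin_diag m.+1 1) bin1.
have m0 : m.+1%:R != 0 :> R by rewrite pnatr_eq0.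
have -> : ('C(m.+1, 2))%:R = m.+1%:R * m%:R / 2 :> R by rewrite -C2 mulrAC mulfV ?mul1r// pnatr_eq0.
have -> : m%:R = m.+1%:R - 1 :> R by rewrite -natr1 addrK.
rewrite /harmonic /=; move: m0; set k := m.+1%:R; set e1 := expR _; set e2 := expR _.
by move=> k0; field.
Qed.

(** Used as the union bound over the pairs. *)
Lemma bernoulli_ge (q : R) (N : nat) : 0 <= q <= 1 -> 1 - N%:R * q <= (1 - q) ^+ N.
Proof.
move=> /andP[q0 q1]; elim: N => [|N IH]; first by rewrite mul0r subr0 expr0.
rewrite exprS; have h : 0 <= 1 - q by rewrite subr_ge0.
apply: le_trans (ler_wpM2l h IH).
rewrite -natr1; have : 0 <= N%:R * q * q by rewrite !mulr_ge0.
by set k := N%:R; nra.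
Qed.

End limits.

Lemma card_vpair n : #|{: vpair n}| = 'C(n, 2).
Proof. by rewrite card_sig -(card_ord n) -card_draws cardsE card_ord. Qed.

(** * The expectation and the theorem *)

Section geometric_tail.
Context {d : measure_display} {Omega : measurableType d} {R : realType}.
Variables (P : probability Omega R) (T : Omega -> \bar R) (a s r : R).
Hypotheses (mT : measurable_fun setT T) (T0 : forall w, (0 <= T w)%E).
Hypotheses (a0 : 0 <= a) (s0 : 0 < s) (r0 : 0 < r) (r1 : r < 1).
Hypothesis tail : forall k : nat,
  (P [set w | ((a + k%:R * s)%:E < T w)%E] <= (r ^+ k)%:E)%E.

Let D (k : nat) : set Omega := [set w | ((a + k%:R * s)%:E < T w)%E].

Let mD k : measurable (D k).
Proof. by rewrite -[D k]setTI; exact: emeasurable_fun_o_infty. Qed.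

(** Beyond [a], the indicators count the steps of length [s] completed below
    [T w]; the step containing [T w] is counted as well. *)
Lemma le_staircase w :
  (T w <= a%:E + s%:E * \sum_(k <oo) (\1_(D k) w)%:E)%E.
Proof.
set S := limn _.
have S0 : (0 <= S)%E by apply: nneseries_ge0 => k _ _; rewrite lee_fin.
have SK K : (forall k, (k < K)%N -> D k w) -> (K%:R%:E <= S)%E.
  move=> HK; apply: le_trans (nneseries_lim_ge K _); last first.
    by move=> k _ _; rewrite lee_fin.
  rewrite (eq_big_nat _ _ (F2 := fun=> 1%:E)).
    by rewrite sumEFin lee_fin sumr_const_nat subn0.
  by move=> k /andP[_ kK]; rewrite indicE mem_set//; exact: HK.
case E : (T w) => [x| |]; last by rewrite leNye.
  have ex : exists K : nat, x <= a + K%:R * s.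
    exists (Num.bound (`|x| / s)).
    have /archi_boundP : 0 <= `|x| / s by rewrite divr_ge0// ltW.
    rewrite ltr_pdivrMr// => /ltW xs; apply: (le_trans (ler_norm x)).
    by apply: (le_trans xs); rewrite lerDr.
  pose K := ex_minn ex.
  have [xK minK] : x <= a + K%:R * s /\ forall j, x <= a + j%:R * s -> (K <= j)%N.
    by rewrite /K; case: ex_minnP.
  have /SK KS : forall k, (k < K)%N -> D k w.
    move=> k kK; rewrite /D /= E lte_fin ltNge; apply/negP => /minK.
    by rewrite leqNgt kK.
  apply: (@le_trans _ _ (a + K%:R * s)%:E); first by rewrite lee_fin.
  by rewrite EFinD leeD2l// mulrC EFinM lee_pmul2l.
have -> : S = +oo%E.
  apply/eqyP => A A0; apply: (@le_trans _ _ (Num.bound A)%:R%:E).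
    by rewrite lee_fin; apply/ltW/archi_boundP/ltW.
  by apply: SK => k _; rewrite /D /= E ltry.
by rewrite gt0_muley ?lte_fin// addey.
Qed.

Lemma expectation_geometric_tail : (\int[P]_w T w <= (a + s / (1 - r))%:E)%E.
Proof.
have mS : measurable_fun setT (fun w => \sum_(k <oo) (\1_(D k) w : R)%:E)%E.
  apply: ge0_emeasurable_sum => k; first by move=> w _ _; rewrite lee_fin.
  by move=> _; apply/measurable_EFinP; exact: measurable_indic.
have S0 w : (0 <= \sum_(k <oo) (\1_(D k) w : R)%:E)%E.
  by apply: nneseries_ge0 => k _ _; rewrite lee_fin.
apply: (@le_trans _ _ (\int[P]_w (a%:E + s%:E * \sum_(k <oo) (\1_(D k) w)%:E))%E).
  apply: ge0_le_integral => //.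
  - by apply: emeasurable_funD => //; exact: measurable_funeM.
  - by move=> w _; exact: le_staircase.
rewrite ge0_integralD//; first last.
- exact: measurable_funeM.
- by move=> w _; rewrite mule_ge0 ?lee_fin// ltW.
rewrite integral_cst// [X in (_ * X)%E]probability_setT mule1 EFinD leeD2l//.
rewrite ge0_integralZl_EFin//; last exact: ltW.
rewrite EFinM lee_pmul2l// integral_nneseries//; last first.
  by move=> k; apply/measurable_EFinP; exact: measurable_indic.
apply: lime_le; first by apply: is_cvg_nneseries => k _ _; apply: integral_ge0 => w _; rewrite lee_fin.
apply: nearW => K.
apply: (@le_trans _ _ (\sum_(0 <= k < K) (r ^+ k)%:E)%E).
  apply: lee_sum => k _; rewrite integral_indic// setIT; exact: tail.
rewrite sumEFin lee_fin -[leRHS]mul1r.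
have := @geometric_le_lim R K 1 r ler01 r0; rewrite gtr0_norm// => /(_ r1).
apply: le_trans; rewrite /series /= le_eqVlt; apply/orP; left; apply/eqP.
by apply: eq_bigr => k _; rewrite mul1r.
Qed.

End geometric_tail.

Theorem corollary1 (R : realType) (alpha beta : R)
  (halpha : 0 < alpha) (hbeta : 0 < beta)
  (d : nat -> measure_display) (Omega : forall n, measurableType (d n))
  (P : forall n, probability (Omega n) R)
  (tau : forall n, vpair n -> nat -> Omega n -> R)
  (upd : forall n, vpair n -> nat -> Omega n -> bool)
  (x0 : forall n, graph_state n)
  (hER : forall n, (2 <= n)%N -> dynamic_ER_updates (P n) (tau n) (upd n) alpha beta)
  (T : forall n, Omega n -> \bar R)
  (hT : forall n, (2 <= n)%N ->
     fastest_time_to_stationarity (P n)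
       (update_filtration (tau n) (upd n))
       (dynamic_ER (tau n) (upd n) (x0 n))
       (@erdos_renyi_pmf R n (edge_prob alpha beta n)) (T n)) :
  (forall x : R,
     P n [set w | (alpha%:E * T n w - (2 * ln n%:R)%:E + (ln 2)%:E <= x%:E)%E]
       @[n --> \oo] --> (expR (- expR (- x)))%:E)
  /\
  (exists C : R, \forall n \near \oo,
     (\int[P n]_w T n w <= (C * ln n%:R)%:E)%E).
Proof.
have n1_gt0 n : (2 <= n)%N -> 0 < n.-1%:R :> R.
  by case: n => [|[|n]]//= _; rewrite ltr0n.
have rate_ge n : (2 <= n)%N -> alpha <= edge_rate alpha beta n.
  by move=> n2; rewrite lerDl divr_ge0// ltW// n1_gt0.
have rate_gt0 n (n2 : (2 <= n)%N) : 0 < edge_rate alpha beta n.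
  exact: lt_le_trans halpha (rate_ge n n2).
have prob01 n : (2 <= n)%N -> 0 < edge_prob alpha beta n < 1.
  move=> n2; have h := mulr_gt0 (n1_gt0 n n2) halpha.
  have D0 : 0 < beta + n.-1%:R * alpha by rewrite addr_gt0.
  by rewrite /edge_prob divr_gt0//= ltr_pdivrMr// mul1r ltrDl.
have law n (t : R) : (2 <= n)%N -> 0 <= t ->
    P n [set w | (T n w <= t%:E)%E] =
    ((1 - expR (- (edge_rate alpha beta n * t))) ^+ 'C(n, 2))%:E.
  move=> n2 t0; rewrite -card_vpair.
  exact: (fastest_time_law (hER n n2) (rate_gt0 n n2) (prob01 n n2) (hT n n2) t0).
split => [x|].
  pose t (n : nat) : R := (x + 2 * ln n%:R - ln 2) / alpha.
  pose u (n : nat) : \bar R := ((1 - expR (- (edge_rate alpha beta n * t n))) ^+ 'C(n, 2))%:E.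
  have cu : u n @[n --> \oo] --> (expR (- expR (- x)))%:E.
    by apply: cvg_EFin; [exact: nearW|exact: gumbel_limit].
  apply: cvg_trans cu; apply: near_eq_cvg.
  exists (maxn 2 (Num.bound (expR (`|x| + ln 2)))) => // n /=.
  rewrite geq_max => /andP[n2 nx].
  have n0 : 0 < n%:R :> R by rewrite ltr0n (leq_trans _ n2).
  have ln2 : 0 <= ln 2 :> R by rewrite ln_ge0// ler1n.
  have lnn : `|x| + ln 2 <= ln n%:R.
    rewrite -ler_expR lnK ?posrE//.
    by apply: (le_trans (ltW (archi_boundP (expR_ge0 _)))); rewrite ler_nat.
  have t0 : 0 <= t n.
    rewrite divr_ge0 ?(ltW halpha)//.
    have := ler_norm (- x); rewrite normrN; have := normr_ge0 x; lra.
  have centre (y : \bar R) : (alpha%:E * y - (2 * ln n%:R)%:E + (ln 2)%:E <= x%:E)%E =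
      (y <= (t n)%:E)%E.
    case: y => [r| |].
    - rewrite -EFinM -EFinB -EFinD !lee_fin /t ler_pdivlMr//.
      by apply/idP/idP => h; lra.
    - by rewrite gt0_muley ?lte_fin// !addye// !leye_eq.
    - by rewrite gt0_muleNy ?lte_fin// !addNye !leNye.
  by rewrite /u -law//; congr (P n _); apply/seteqP; split => w /=; rewrite centre.
have ln2_gt0 : 0 < ln 2 :> R by rewrite ln_gt0// ltr1n.
have e1 : expR (- 1) < 1 :> R by rewrite -[ltRHS]expR0 ltr_expR oppr_lt0.
pose c : R := alpha^-1 / (1 - expR (- 1)).
have c0 : 0 <= c by rewrite divr_ge0 ?invr_ge0 ?subr_ge0 ?ltW.
exists (2 / alpha + c / ln 2); exists 2%N => // n /= n2.
have n0 : 0 < n%:R :> R by rewrite ltr0n (leq_trans _ n2).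
have lnn : ln 2 <= ln n%:R :> R by rewrite ler_ln ?posrE ?ler_nat.
have [[[mT T0 _] _] _] := hT n n2.
have a0 : 0 <= 2 * ln n%:R / alpha.
  by rewrite divr_ge0 ?(ltW halpha)// mulr_ge0// (le_trans _ lnn)// ltW.
apply: (@le_trans _ _ (2 * ln n%:R / alpha + alpha^-1 / (1 - expR (- 1)))%:E).
  apply: expectation_geometric_tail => //; rewrite ?invr_gt0 ?expR_gt0// => k.
  set t := _ + _ * _.
  have t0 : 0 <= t by rewrite addr_ge0// mulr_ge0// invr_ge0 ltW.
  have -> : [set w | (t%:E < T n w)%E] = ~` [set w | (T n w <= t%:E)%E].
    by apply/seteqP; split => w /=; rewrite ltNge => /negP.
  have mb : measurable [set w | (T n w <= t%:E)%E].
    by rewrite -[mkset _]setTI; exact: emeasurable_fun_infty_c.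
  rewrite probability_setC// law// -EFinB lee_fin.
  set q := expR (- (edge_rate alpha beta n * t)).
  have q01 : 0 <= q <= 1.
    rewrite expR_ge0/= -[leRHS]expR0 ler_expR oppr_le0 mulr_ge0//.
    exact/ltW/rate_gt0.
  have := bernoulli_ge 'C(n, 2) q01.
  rewrite lerBlDr -lerBlDl => /le_trans; apply.
  have -> : expR (- 1) ^+ k = n%:R ^+ 2 * (n%:R ^- 2 * expR (- 1) ^+ k) :> R.
    by rewrite mulrA mulfV ?mul1r// expf_neq0// gt_eqF.
  apply: ler_pM => //; first by case/andP: q01.
    rewrite -natrX ler_nat -(leq_pmul2l (isT : 0 < 2)%N) -(mul_bin_diag n 1) bin1.
    by rewrite -mulnn mulnCA leq_mul// (leq_trans (leq_pred n))// leq_pmull.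
  apply: (@le_trans _ _ (expR (- (alpha * t)))).
    by rewrite ler_expR lerN2 ler_wpM2r// rate_ge.
  have -> : - (alpha * t) = - ln n%:R - ln n%:R + k%:R * - 1.
    by rewrite /t; field; rewrite gt_eqF.
  by rewrite !expRD expRM_natl expRN lnK ?posrE// expr2 invfM.
rewrite lee_fin [leRHS]mulrDl; apply: lerD; first by rewrite mulrAC.
by rewrite -/c -mulrA ler_peMr// mulrC ler_pdivlMr// mul1r.
Qed.
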